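(* Let $a$ be an integer with $a\neq 0,\pm1$, and let $a=\pm a_0^e$, where $e$ is the largest positive integer such that $|a|$ is a perfect $e$-th power and $a_0$ is the integer with $|a|=|a_0|^e$ and $\operatorname{sign}(a_0)=\operatorname{sign}(a)$. Let $K=\mathbb{Q}(a_0^{1/2})$ and let $D$ be the discriminant of $K$. For $n\ge 1$ let $G(n)=\mathrm{Gal}(\mathbb{Q}(\zeta_n,a^{1/n})/\mathbb{Q})$ and let $A(n)$ be the group of automorphisms of the group $R_n$ of $n$-radicals of $a$ that fix $\mathbb{Q}^\times\cap R_n$ elementwise (see context). Let $g$ be a multiplicative arithmetic function such that $$\sum_{n=1}^{\infty}\frac{|g(n)|}{\#G(n)}<\infty .$$ Then $$\sum_{n=1}^{\infty}\frac{g(n)}{\#G(n)}=\prod_p\sum_{k\geq 0}\frac{g(p^k)}{\#A(p^k)}+\prod_{p}\sum_{k\geq\ell(p)}\frac{g(p^k)}{\#A(p^k)},$$ where the products are over all primes $p$ and $$\ell(p)=\begin{cases} 0&\text{if } p \text{ is odd and } p\nmid D,\\ 1&\text{if } p \text{ is odd and } p\mid D,\\ s&\text{if } p=2 \text{ and } D \text{ is odd},\\ \max\{2,s\}&\text{if } p=2 \text{ and } 4\Vert D,\\ 2&\text{if } p=2,\ 8\Vert D,\text{ and } (\nu_2(e)=1 \text{ and } a<0),\\ \max\{3,s\}&\text{if } p=2,\ 8\Vert D,\text{ and } (\nu_2(e)\neq 1 \text{ or } a>0), \end{cases}$$ with $$s=\begin{cases}\nu_2(e)+1&\text{if } e \text{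 is odd or } a>0,\\ \nu_2(e)+2&\text{if } e \text{ is even and } a<0.\end{cases}$$
   Context: Fix an algebraic closure $\overline{\mathbb{Q}}$ of $\mathbb{Q}$. $\zeta_n\in\overline{\mathbb{Q}}$ denotes a primitive $n$-th root of unity, and $\mathbb{Q}(\zeta_n,a^{1/n})$ is the splitting field of $x^n-a$ over $\mathbb{Q}$. For a prime $p$, $\nu_p(e)$ is the exponent of $p$ in the factorization of $e$. The notation $p^j\Vert D$ means $p^j\mid D$ and $p^{j+1}\nmid D$. The group of $n$-radicals of $a$ is the multiplicative group $R_n=\{\alpha\in\overline{\mathbb{Q}}^{\times}:\alpha^n\in\langle a\rangle\}$, where $\langle a\rangle$ is the subgroup of $\overline{\mathbb{Q}}^\times$ generated by $a$. $A(n)=\mathrm{Aut}_{\mathbb{Q}^{\times}\cap R_n}(R_n)$ is the (finite) group of group automorphisms of $R_n$ that are the identity on $\mathbb{Q}^\times\cap R_n$. An arithmetic function is a complex-valued function on the positive integers; it is multiplicative if $g(1)=1$ and $g(mn)=g(m)g(n)$ for coprime $m,n$. *)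

(* Defs.v *)
From HB Require Import structures.
From mathcomp Require Import all_boot all_order all_algebra all_fingroup all_field.
From mathcomp Require Import finmap.
From mathcomp Require Import all_classical all_reals all_analysis.
From mathcomp Require Import complex.

Set Implicit Arguments.
Unset Strict Implicit.
Unset Printing Implicit Defensive.

Import Order.TTheory GRing.Theory Num.Theory.
Import numFieldNormedType.Exports.

Local Open Scope classical_set_scope.
Local Open Scope ring_scope.

Fact splitting_num_field (p : {poly rat}) :
  {L : splittingFieldType rat |
    p != 0 -> splittingFieldFor 1 (map_poly (in_alg L) p) {:L}}.
Proof.
wlog p0 : p / p != 0.
  move=> H; case: (boolP (p == 0)) => [p0|p0].
    by have [L _] := H 1 (oner_neq0 _); exists L; rewrite ?p0.
  by have [L hL] := H p p0; exists L => _; exact: (hL p0).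
have [rs Drs] := closed_field_poly_normal (map_poly (ratr : rat -> algC) p).
have [L [LC [s Ds genL]]] := num_field_exists rs.
have split_p : splittingFieldFor 1 (map_poly (in_alg L) p) {:L}.
  exists s => //; rewrite -(eqp_map LC) -map_poly_comp. 
  have -> : map_poly (LC \o in_alg L) p = map_poly (ratr : rat -> algC) p.
    by apply: eq_map_poly => x; rewrite /= alg_num_field fmorph_rat.
  rewrite Drs -Ds rmorph_prod /= big_map.
  under [X in _ %= X]eq_bigr do rewrite map_polyXsubC.
  by rewrite eqp_scale// lead_coef_eq0 map_poly_eq0.
have splL : SplittingField.axiom L.
  exists (map_poly (in_alg L) p) => //.
  by apply/polyOverP => i; rewrite coef_map /= rpredZ ?rpred1 ?mem1v.
pose M := FieldExt_isSplittingField.Build rat L splL.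
pose L' : splittingFieldType rat := HB.pack L M.
by exists L'.
Qed.

Definition splitting_Xn_sub (a : int) (n : nat) : splittingFieldType rat :=
  sval (splitting_num_field ('X^n - (a%:~R)%:P)).

Definition cardG (a : int) (n : nat) : nat :=
  #|'Gal({: splitting_Xn_sub a n} / 1)%g|.

(* R_n, with algC as the fixed algebraic closure of Q. *)
Definition radicals (a : int) (n : nat) : set algC :=
  [set alpha | alpha != 0 /\ exists k : int, alpha ^+ n = a%:~R ^ k].

Definition radical_group (a : int) (n : nat) : Type := set_type (radicals a n).

HB.instance Definition _ (a : int) (n : nat) := Choice.on (radical_group a n).

Section RadicalGroup.
Variables (a : int) (n : nat).

Fact radicals1 : radicals a n 1.
Proof. by split; [exact: oner_neq0 | exists 0; rewrite expr1n expr0z]. Qed.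

Fact radicalsV (x : algC) : radicals a n x -> radicals a n x^-1.
Proof.
move=> [x0 [k xk]]; split; first by rewrite invr_eq0.
by exists (- k); rewrite exprVn xk invr_expz.
Qed.

Fact radicalsM (x y : algC) :
  radicals a n x -> radicals a n y -> radicals a n (x * y).
Proof.
move=> [x0 [k xk]] [y0 [l yl]]; split; first by rewrite mulf_neq0.
have [a0|a0] := eqVneq (a%:~R : algC) 0; last first.
  by exists (k + l); rewrite expfzDr// exprMn xk yl.
exists 0; rewrite exprMn expr0z.
move: (expf_neq0 n x0) (expf_neq0 n y0); rewrite xk yl a0 !exp0rz.
by case: (k == 0) => //; rewrite ?eqxx// mul1r; case: (l == 0); rewrite ?eqxx.
Qed.

Definition radical_mk (x : algC) (hx : radicals a n x) : radical_group a n :=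
  SigSub (mem_set hx).

Definition radical_one : radical_group a n := radical_mk radicals1.
Definition radical_inv (x : radical_group a n) : radical_group a n :=
  radical_mk (radicalsV (set_valP x)).
Definition radical_mul (x y : radical_group a n) : radical_group a n :=
  radical_mk (radicalsM (set_valP x) (set_valP y)).

Fact radical_mulA : associative radical_mul.
Proof. by move=> x y z; apply: val_inj; rewrite /= mulrA. Qed.
Fact radical_mul1 : left_id radical_one radical_mul.
Proof. by move=> x; apply: val_inj; rewrite /= mul1r. Qed.
Fact radical_mulr1 : right_id radical_one radical_mul.
Proof. by move=> x; apply: val_inj; rewrite /= mulr1. Qed.
Fact radical_mulV : left_inverse radical_one radical_inv radical_mul.
Proof.
by move=> x; apply: val_inj; rewrite /= mulVf//; have [] := set_valP x.
Qed.
Fact radical_mulrV : right_inverse radical_one radical_inv radical_mul.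
Proof.
by move=> x; apply: val_inj; rewrite /= mulfV//; have [] := set_valP x.
Qed.

HB.instance Definition _ := isGroup.Build (radical_group a n)
  radical_mulA radical_mul1 radical_mulr1 radical_mulV radical_mulrV.

End RadicalGroup.

(* The automorphisms of R_n that are the identity on R_n `&` Q^x; fset_set turns
   this finite set of functions into an {fset _}. *)
Definition radical_aut (a : int) (n : nat) :
    set (radical_group a n -> radical_group a n) :=
  [set f : radical_group a n -> radical_group a n |
    [/\ {morph f : x y / (x * y)%g}, bijective f
       & forall x, set_val x \in Crat -> f x = x]].

Definition cardA (a : int) (n : nat) : nat :=
  #|` fset_set (@radical_aut a n)|%fset.

(* Trace of the multiplication by x, as a Q-linear endomorphism of K. *)
Definition field_trace (K : fieldExtType rat) (x : K) : rat :=
  \tr (passmx.mxof (vbasis {:K}) (vbasis {:K}) (amulr x)).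

(* b is a Z-basis of the ring of integers of K. *)
Definition integral_basis (K : fieldExtType rat)
    (b : (\dim {:K}).-tuple K) : Prop :=
  basis_of {:K} b /\
  forall x : K, integralOver (intr : int -> K) x <->
    exists c : 'I_(\dim {:K}) -> int,
      x = \sum_i tnth b i *~ c i.

Definition is_discriminant (K : fieldExtType rat) (D : int) : Prop :=
  exists2 b : (\dim {:K}).-tuple K, integral_basis b &
    D%:~R = \det (\matrix_(i, j) field_trace (tnth b i * tnth b j)).

Definition perfect_power (m k : nat) : Prop := exists b : nat, m = (b ^ k)%N.

(* p ^ j || D *)
Definition exactly_divides (p j : nat) (D : int) : bool :=
  ((p ^ j)%N%:Z %| D)%Z && ~~ ((p ^ j.+1)%N%:Z %| D)%Z.

Definition s_exp (a : int) (e : nat) : nat :=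
  if odd e || (0 < a) then (logn 2 e).+1 else (logn 2 e).+2.

(* The last default value is never used: the discriminant of a quadratic field
   is odd or exactly divisible by 4 or by 8. *)
Definition ell (a : int) (e : nat) (D : int) (p : nat) : nat :=
  if odd p then (if (p%:Z %| D)%Z then 1 else 0)
  else if ~~ (2 %| D)%Z then s_exp a e
  else if exactly_divides 2 2 D then maxn 2 (s_exp a e)
  else if exactly_divides 2 3 D then
    (if (logn 2 e == 1)%N && (a < 0) then 2 else maxn 3 (s_exp a e))
  else 0.

Section Series.
Variable R : realType.

(* The regular module R[i]^o carries the topology of the norm of R[i]. *)
Implicit Type g : nat -> R[i]^o.

Definition multiplicative_arith g : Prop :=
  g 1 = 1 /\ forall m n : nat, (0 < m)%N -> (0 < n)%N -> coprime m n ->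
               g (m * n)%N = g m * g n.

Definition termG (a : int) g (n : nat) : R[i]^o := g n / (cardG a n)%:R.

Definition termA (a : int) g (n : nat) : R[i]^o := g n / (cardA a n)%:R.

Definition local_partial (a : int) g (p l : nat) : nat -> R[i]^o :=
  fun N => \sum_(l <= k < N) termA a g (p ^ k).

(* Partial products over the primes p < N, of the sums over k >= l p. *)
Definition euler_partial (a : int) g (l : nat -> nat) : nat -> R[i]^o :=
  fun N => \prod_(0 <= p < N | prime p) limn (local_partial a g p (l p)).

End Series.

(* Main.v *)
Require Import Defs.
From HB Require Import structures.
From mathcomp Require Import all_boot all_order all_algebra all_fingroup all_field.
From mathcomp Require Import finmap.
From mathcomp Require Import all_classical all_reals all_analysis.
From mathcomp Require Import complex ring lra zify.
Import Order.TTheory GRing.Theory Num.Theory.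
Import numFieldNormedType.Exports.
Local Open Scope classical_set_scope.
Local Open Scope ring_scope.

(** Fix [n], a primitive [n]-th root of unity [z] and an [n]-th root [al] of
    [a].  The [n]-radicals are the elements [z ^+ j * al ^ k].  An automorphism
    of this group is determined by the images of [z] and [al]; if [d] is the
    least positive exponent for which [a ^+ d] is the [n]-th power of a
    rational, fixing the rational radicals amounts to fixing one element
    [z ^+ j0 * al ^+ d], which leaves [d] choices for [al] for each of the
    [totient n] choices for [z].  So [#A(n) = totient n * d] (lemma
    [cardA_totient]).  In the same way [#G(n) = totient n * d'], where [d'] is
    the least positive exponent for which [a ^+ d'] is an [n]-th power in the
    field [Q(z)] (lemma [cardG_totient]).

    The exponents [d] and [d'] are almost equal.  Let [ga] in [Q(z)] satisfy
    [ga ^+ n = a ^+ k].  Complex conjugation commutes with all automorphisms of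
    [Q(z)], and these multiply [ga] by roots of unity; hence [ga * ga^*] is
    rational, and [a ^+ k.*2] is the [n]-th power of a rational.  Therefore
    [d' = d], or [d] is even and [d' = d / 2] (lemma [cyclotomic_indexP]); the
    second case occurs when [a ^+ (d / 2)] is an [n]-th power in [Q(z)].  An
    explicit [n]-th root of [a ^+ (d / 2)] is an odd power of [sqrt a0], or the
    product of such a power with a root of [x ^+ n = -1] when [a < 0] and [e]
    is even with one factor [2] less than [n], or a rational multiple of a root
    of [x ^+ n = -1], which is not in [Q(z)].  So the question is which square
    roots lie in a cyclotomic field.

    The field [Q(sqrt m)], with [m] squarefree, lies in [Q(z)] exactly if its
    discriminant divides [n] (lemma [sqrt_in_cyclotomicP]); this discriminant
    is [m] or [4 * m] (lemma [is_discriminant_quadratic]).  One direction is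
    the quadratic Gauss sum.  For the other one, each prime power that divides the
    discriminant but not [n] gives an automorphism that fixes [z] and moves
    [sqrt m].  With the root of [x ^+ n = -1] as a factor, the condition at [2]
    changes: now [m] must be even and [n] must be [4] times an odd number
    (lemma [twisted_sqrt_in_cyclotomicP]).  This is the origin of the
    exceptional value [2] of [ell].  Altogether [d' = d / 2] holds exactly if
    [ell p <= logn p n] for all primes [p] (lemma [entangledP]).

    It follows that [g n / #G(n)] is [f n], or twice [f n] when [n] satisfies
    these inequalities, where [f n = g n / #A(n)] is multiplicative and
    absolutely summable.  The sum of [f] over all [n] and its sum over the [n]
    that satisfy the inequalities are the two Euler products (lemma
    [euler_product]). *)

Set Implicit Arguments.
Unset Strict Implicit.
Unset Printing Implicit Defensive.

(** * Absolutely convergent Euler products over the complex numbers *)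

Section Completeness.
Local Open Scope complex_scope.
Variable R : realType.
Implicit Type u : nat -> R[i]^o.

Lemma normc_i : `|'i%C : R[i]| = 1.
Proof. by rewrite normc_def /= expr0n expr1n add0r sqrtr1. Qed.

Lemma normc_real (x : R) : `|x%:C| = `|x|%:C.
Proof. by rewrite normc_def /= expr0n addr0 sqrtr_sqr. Qed.

Lemma normc_le_ReIm (z : R[i]) : `|z| <= (`|complex.Re z| + `|complex.Im z|)%:C.
Proof.
rewrite {1}(complexE z) (le_trans (ler_normD _ _))// normrM normc_i mul1r.
by rewrite !normc_real rmorphD.
Qed.

Lemma normc_ge_Im (z : R[i]) : `|complex.Im z|%:C <= `|z|.
Proof.
by have := normc_ge_Re (z * 'i%C); rewrite ReiNIm normrN normrM normc_i mulr1.
Qed.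

(** Real and imaginary parts inherit the Cauchy property, and the real numbers
    are complete. *)
Lemma cauchy_cvgn_complex u :
  (forall eps : R, 0 < eps ->
    exists X, forall n, (X <= n)%N -> `|u n - u X| <= eps%:C) -> cvgn u.
Proof.
move=> uC.
have cvF (f : R[i] -> R) : {morph f : x y / x - y} ->
    (forall z, `|f z|%:C <= `|z|) -> cvgn (f \o u).
  move=> fB fle; apply: cauchy_cvg; apply/cauchy_ballP => eps eps0.
  have [X uX] := uC (eps / 4) ltac:(by rewrite divr_gt0).
  have H n : (X <= n)%N -> `|f (u n) - f (u X)| <= eps / 4.
    by move=> Xn; rewrite -fB -lecR (le_trans (fle _)) ?uX.
  exists ([set f (u n) | n in [set n | (X <= n)%N]],
          [set f (u n) | n in [set n | (X <= n)%N]]) => /=.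
    by split; exists X => // n /= Xn; exists n.
  move=> [x y] /= [[n Xn <-] [m Xm <-]].
  rewrite /ball /=.
  have -> : f (u n) - f (u m) = (f (u n) - f (u X)) - (f (u m) - f (u X)).
    by rewrite opprB addrA subrK.
  rewrite (le_lt_trans (ler_normB _ _))//.
  rewrite (le_lt_trans (lerD (H _ Xn) (H _ Xm)))//.
  lra.
have cRe : cvgn (@complex.Re R \o u).
  by apply: cvF => [[? ?] [? ?]|z] //; exact: normc_ge_Re.
have cIm : cvgn (@complex.Im R \o u).
  by apply: cvF => [[? ?] [? ?]|z] //; exact: normc_ge_Im.
apply/cvg_ex; exists (Complex (limn (@complex.Re R \o u)) (limn (@complex.Im R \o u))).
apply/cvgrPdist_le => eps; rewrite ltcE /= => /andP[/eqP eps1 eps0].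
have -> : eps = (complex.Re eps)%:C by case: eps eps1 {eps0} => ? ? /= ->.
move/cvgrPdist_le: cRe => /(_ (complex.Re eps / 2)) []; first by rewrite divr_gt0.
move=> N1 _ H1.
move/cvgrPdist_le: cIm => /(_ (complex.Re eps / 2)) []; first by rewrite divr_gt0.
move=> N2 _ H2.
exists (maxn N1 N2) => // n /=; rewrite geq_max => /andP[n1 n2].
rewrite (le_trans (normc_le_ReIm _))// lecR.
have := H1 n n1; have := H2 n n2 => /=; case: (u n) => x y /=; lra.
Qed.

End Completeness.

(** Absolute summability, expressed by finite sums over arbitrary finite sets
    of large indices; in this form it passes at once to rearrangements and to
    subfamilies. *)
Definition small_tails (R : realType) (f : nat -> R[i]^o) : Prop :=
  forall eps : R, 0 < eps -> exists X : nat, forall s : seq nat, uniq s ->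
    (forall n, n \in s -> (X <= n)%N) -> \sum_(n <- s) `|f n| <= (eps%:C)%C.

Section SmallTails.
Variable R : realType.
Local Open Scope complex_scope.
Implicit Type f h : nat -> R[i]^o.

Lemma small_tailsP f h : (forall n, (0 < n)%N -> `|f n| <= h n) ->
  cvgn (fun N => \sum_(1 <= n < N) h n) -> small_tails f.
Proof.
move=> fh /cvg_ex [l /cvgrPdist_le cl] eps eps0.
have [|X _ HX] := cl (eps / 2)%:C; first by rewrite ltcR divr_gt0.
exists X.+1 => s us sX.
have h0 n : (0 < n)%N -> 0 <= h n by move=> n0; rewrite (le_trans _ (fh n n0)).
set W := (X.+1 + \max_(n <- s) n.+1)%N.
have sW n : n \in s -> (n < W)%N.
  move=> ns; rewrite ltn_addl//.
  by rewrite (big_rem _ ns) /= leq_max leqnn.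
have -> : \sum_(n <- s) `|f n| = \sum_(X.+1 <= n < W | n \in s) `|f n|.
  rewrite -[RHS]big_filter; apply: perm_big; apply: uniq_perm => //.
    exact/filter_uniq/iota_uniq.
  move=> n; rewrite mem_filter mem_index_iota.
  by case: (boolP (n \in s)) => //= ns; rewrite sX//= sW.
have -> : eps%:C = (eps / 2)%:C + (eps / 2)%:C by rewrite -rmorphD -splitr.
apply: (@le_trans _ _ (\sum_(X.+1 <= n < W) h n)).
  rewrite big_mkcond /= big_seq [leRHS]big_seq; apply: ler_sum => n.
  rewrite mem_index_iota => /andP[Xn _].
  have n0 : (0 < n)%N by case: n Xn.
  by case: ifP => _; rewrite ?fh ?h0.
have WX : (X.+1 <= W)%N by rewrite leq_addr.
have E : \sum_(X.+1 <= n < W) h n =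
    (l - \sum_(1 <= n < X.+1) h n) - (l - \sum_(1 <= n < W) h n).
  by rewrite [\sum_(1 <= n < W) h n](big_cat_nat (ltn0Sn X : (1 <= X.+1)%N) WX)//=; ring.
have -> : \sum_(X.+1 <= n < W) h n = `|\sum_(X.+1 <= n < W) h n|.
  by rewrite ger0_norm// big_seq sumr_ge0// => n; rewrite mem_index_iota => /andP[Xn _];
     apply: h0; case: n Xn.
rewrite E (le_trans (ler_normB _ _))// lerD ?HX//=.
by rewrite (leq_trans _ WX).
Qed.

Variables (f : nat -> R[i]^o) (sf : small_tails f).

Lemma small_tails_cvgn (F : nat -> nat) (P : pred nat) m :
  (forall k, (k <= F k)%N) -> injective F ->
  cvgn (fun N => \sum_(m <= k < N | P k) f (F k)).
Proof.
move=> Fk Finj; apply: cauchy_cvgn_complex => eps eps0.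
have [X HX] := sf eps0; exists (maxn m X) => n Xn.
rewrite (big_cat_nat (leq_maxl m X) Xn) /= addrAC subrr add0r.
rewrite (le_trans (ler_norm_sum _ _ _))//.
rewrite -big_filter -(big_map F xpredT (fun n => `|f n|)) HX//.
  by rewrite map_inj_uniq// filter_uniq// iota_uniq.
move=> _ /mapP[k + ->]; rewrite mem_filter mem_index_iota geq_max.
by move=> /and3P[_ /andP[_ Xk] _]; rewrite (leq_trans Xk).
Qed.

End SmallTails.

(** The integers occurring in the expansion of the product over the primes
    [p < N] of the sums over [ell p <= k < M]. *)
Fixpoint euler_support (ell : nat -> nat) (M N : nat) : seq nat :=
  if N is p.+1 then
    let s := euler_support ell M p in
    if prime p then [seq (n * p ^ k)%N | n <- s, k <- index_iota (ell p) M] else s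
  else [:: 1%N].

Section EulerSupport.
Variables (ell : nat -> nat) (M : nat).
Local Notation T := (euler_support ell M).

Lemma euler_supportP N n : n \in T N -> (0 < n)%N /\
  forall p, prime p ->
    if (p < N)%N then (ell p <= logn p n < M)%N else (logn p n == 0)%N.
Proof.
elim: N n => [|q IH] n /=; first by rewrite inE => /eqP ->; split=> // p; rewrite logn1.
case: ifP => [pq|npq]; last first.
  move=> /IH[n0 H]; split=> // p pp; have := H p pp.
  by rewrite ltnS [(p <= q)%N]leq_eqVlt; case: (p =P q) => [pq|//]; move: npq; rewrite -pq pp.
move=> /allpairsP[[m k] /= [/IH[m0 H] kM ->]].
have q0 := prime_gt0 pq; split; first by rewrite muln_gt0 m0 expn_gt0 q0.
move=> p pp; rewrite lognM ?expn_gt0 ?q0// lognX (logn_prime _ pq).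
have := H p pp; rewrite ltnS [(p <= q)%N]leq_eqVlt; case: (p =P q) => [->|/eqP pq'] /=.
  by rewrite ltnn => /eqP ->; rewrite muln1 -mem_index_iota.
by rewrite muln0 addn0.
Qed.

Lemma mem_euler_support N n : (0 < n)%N ->
  (forall p, prime p ->
    if (p < N)%N then (ell p <= logn p n < M)%N else (logn p n == 0)%N) ->
  n \in T N.
Proof.
elim: N n => [|q IH] n n0 H /=.
  rewrite inE eqn_leq n0 andbT leqNgt; apply/negP => n1.
  have := H _ (pdiv_prime n1); rewrite ltn0 -leqn0 leqNgt.
  by rewrite logn_gt0 pi_pdiv n1.
case: ifP => [pq|npq]; last first.
  apply: IH => // p pp; have := H p pp.
  by rewrite ltnS [(p <= q)%N]leq_eqVlt; case: (p =P q) => [pq|//]; move: npq; rewrite -pq pp.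
apply/allpairsP; exists (n`_q^', logn q n)%N; split=> /=.
- apply: IH => [|p pp]; first exact: part_gt0.
  have nE : (logn p n = logn p n`_q^' + logn q n * (p == q))%N.
    rewrite -(logn_prime p pq) -lognX -lognM ?part_gt0 ?expn_gt0 ?prime_gt0//.
    by rewrite -p_part mulnC partnC.
  have := H p pp; rewrite ltnS [(p <= q)%N]leq_eqVlt.
  move: nE; case: (p =P q) => [->|_]; last by rewrite muln0 addn0 => ->.
  by rewrite ltnn muln1 => nE _; rewrite -(eqn_add2r (logn q n)) -nE.
- by rewrite mem_index_iota; have := H _ pq; rewrite ltnSn.
- by rewrite -p_part mulnC partnC.
Qed.

Lemma uniq_euler_support N : uniq (T N).
Proof.
elim: N => //= q IH; case: ifP => // pq.
apply: allpairs_uniq => //; first exact: iota_uniq.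
move=> [m k] [m' k'] /allpairsP[[x y] /= [xT yT [-> ->]]].
move=> /allpairsP[[x' y'] /= [xT' yT' [-> ->]]] E.
have [x0 /(_ q pq)] := euler_supportP xT; rewrite ltnn => /eqP lx.
have [x0' /(_ q pq)] := euler_supportP xT'; rewrite ltnn => /eqP lx'.
have q0 := prime_gt0 pq.
have yy' : y = y'.
  have := congr1 (logn q) E.
  by rewrite !lognM ?expn_gt0 ?q0// !pfactorK// lx lx'.
by move/eqP: E; rewrite yy' eqn_pmul2r ?expn_gt0 ?q0// => /eqP ->.
Qed.

Lemma sum_euler_support (R : realType) (g : nat -> R[i]^o) N :
  g 1%N = 1 ->
  (forall m n, (0 < m)%N -> (0 < n)%N -> coprime m n -> g (m * n)%N = g m * g n) ->
  \sum_(n <- T N) g n = \prod_(0 <= p < N | prime p) \sum_(ell p <= k < M) g (p ^ k)%N.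
Proof.
move=> g1 gM; elim: N => [|q IH]; first by rewrite big_geq// big_seq1.
rewrite [in RHS]big_mkcond /= big_nat_recr//= -big_mkcond /= -IH /=.
case: ifP => pq; last by rewrite mulr1.
rewrite big_allpairs_dep big_distrl /= big_seq [RHS]big_seq; apply: eq_bigr => n nT.
rewrite big_distrr; apply: eq_bigr => k _.
have [n0 /(_ q pq)] := euler_supportP nT; rewrite ltnn => /eqP ln.
rewrite gM ?expn_gt0 ?(prime_gt0 pq)// coprimeXr//.
rewrite coprime_sym prime_coprime//; apply/negP => /= qn.
by move: ln; rewrite lognE pq n0 qn.
Qed.

End EulerSupport.

Lemma cvgn_bigprod (K : numFieldType) (F : nat -> nat -> K^o) (P : pred nat) N :
  (forall p, P p -> cvgn (F p)) ->
  (fun M => \prod_(0 <= p < N | P p) F p M) @ \oo -->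
    \prod_(0 <= p < N | P p) limn (F p).
Proof.
move=> cF; elim: N => [|N IH].
  have -> : (fun M => \prod_(0 <= p < 0 | P p) F p M) = fun=> 1.
    by apply/funext => M; rewrite big_geq.
  by rewrite big_geq//; exact: cvg_cst.
have recr (h : nat -> K^o) : \prod_(0 <= p < N.+1 | P p) h p =
    (\prod_(0 <= p < N | P p) h p) * (if P N then h N else 1).
  by rewrite big_mkcond big_nat_recr//= -big_mkcond.
have -> : (fun M => \prod_(0 <= p < N.+1 | P p) F p M) =
    (fun M => (\prod_(0 <= p < N | P p) F p M) * (if P N then F N M else 1)).
  by apply/funext => M; rewrite recr.
have cN : (fun M => if P N then F N M else 1 : K^o) @ \oo -->
    (if P N then limn (F N) else 1 : K^o).
  by case: ifP => [/cF//|_]; exact: cvg_cst.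
rewrite recr; exact: (@cvgM _ _ _ _ _ _ _ _ IH cN).
Qed.

Section EulerProduct.
Variables (R : realType) (f : nat -> R[i]^o).
Local Open Scope complex_scope.
Hypothesis sf : small_tails f.

Lemma local_series_cvgn p l : prime p ->
  cvgn (fun N => \sum_(l <= k < N) f (p ^ k)%N).
Proof.
move=> pp; apply: (small_tails_cvgn sf).
  by move=> k; rewrite ltnW// ltn_expl// prime_gt1.
by move=> i j /eqP; rewrite eqn_exp2l ?prime_gt1// => /eqP.
Qed.

Hypothesis f1 : f 1%N = 1.
Hypothesis fM : forall m n, (0 < m)%N -> (0 < n)%N -> coprime m n ->
  f (m * n)%N = f m * f n.

Variables (ell : nat -> nat) (B : nat) (E : pred nat).
Hypothesis ellB : forall p, prime p -> (B <= p)%N -> ell p = 0%N.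
Hypothesis EP : forall n, (0 < n)%N ->
  reflect (forall p, prime p -> (ell p <= logn p n)%N) (E n).

(** The product over [p < N] of the local sums truncated at [M] is the sum of
    [f] over [euler_support ell M N].  When [N] and [M] are at least [Z], and
    [Z] is at least [B], this set contains the [n < Z] that satisfy [E], and no
    other [n < Z]; so the product differs from a partial sum of the series by a
    sum over indices that are at least [Z], uniformly in [M]. *)
Lemma euler_product :
  (fun N => \prod_(0 <= p < N | prime p) limn (fun M => \sum_(ell p <= k < M) f (p ^ k)%N))
    @ \oo --> limn (fun N => \sum_(1 <= n < N | E n) f n).
Proof.
set P := fun N => _; set S := fun N => \sum_(1 <= n < N | E n) f n.
have cS : cvgn S by apply: (@small_tails_cvgn _ _ sf id).
pose Q N M := \prod_(0 <= p < N | prime p) \sum_(ell p <= k < M) f (p ^ k)%N.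
have cQ N : Q N @ \oo --> P N.
  apply: (@cvgn_bigprod _ (fun p M => \sum_(ell p <= k < M) f (p ^ k)%N)) => p pp.
  exact: local_series_cvgn.
apply/cvgrPdist_le => eps; rewrite ltcE /= => /andP[/eqP eps1 eps0].
have -> : eps = (complex.Re eps)%:C by case: eps eps1 {eps0} => ? ? /= ->.
set e := complex.Re eps / 3; have e0 : 0 < e by rewrite divr_gt0.
have -> : complex.Re eps = e + e + e by rewrite /e; field.

have [X HX] := sf e0.
pose Y := maxn X B.
have SZ Z M N : (Y <= Z)%N -> (Z <= M)%N -> (Z <= N)%N -> `|Q N M - S Z| <= e%:C.
  move=> YZ ZM ZN; rewrite /Q -sum_euler_support//.
  set T := euler_support ell M N.
  have -> : S Z = \sum_(n <- T | (n < Z)%N) f n.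
    rewrite /S -big_filter -[RHS]big_filter; apply: perm_big; apply: uniq_perm.
    - exact/filter_uniq/iota_uniq.
    - exact/filter_uniq/uniq_euler_support.
    move=> n; rewrite !mem_filter mem_index_iota.
    apply/andP/andP => [[/[dup] En0 /EP En /andP[n0 nZ]]|[nZ /euler_supportP[n0 H]]].
      split=> //; apply: mem_euler_support => // p pp.
      case: ifPn => [_|].
        by rewrite En//= (leq_trans (ltn_logl _ n0))// (leq_trans (ltnW nZ)).
      rewrite -leqNgt => Np; rewrite eqn0Ngt logn_gt0 mem_primes.
      apply/negP => /and3P[_ _ /dvdn_leq].
      by move=> /(_ n0); rewrite leqNgt (leq_trans nZ)// (leq_trans ZN).
    split; last by rewrite n0 nZ.
    apply/EP => // p pp; have := H p pp; case: ifPn => [_ /andP[]//|].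
    rewrite -leqNgt => Np _; rewrite ellB// (leq_trans _ Np)// (leq_trans _ ZN)// (leq_trans _ YZ)//.
    exact: leq_maxr.
  rewrite [X in X - _](bigID (fun n => (n < Z)%N)) /= addrAC subrr add0r.
  rewrite (le_trans (ler_norm_sum _ _ _))// -big_filter HX//.
    exact/filter_uniq/uniq_euler_support.
  move=> n; rewrite mem_filter -leqNgt => /andP[+ _]; apply: leq_trans.
  by rewrite (leq_trans _ YZ)// leq_maxl.
have e0C : 0 < e%:C by rewrite ltcR.
move/cvgrPdist_le: (cS) => /(_ _ e0C)[Z0 _ HZ0].
pose Z := maxn Y Z0.
exists Z => // N /= ZN.
move/cvgrPdist_le: (cQ N) => /(_ _ e0C)[M0 _ HM].
pose M := maxn Z M0.
have -> : limn S - P N = (limn S - S Z) - (P N - Q N M) - (Q N M - S Z) by ring.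
rewrite !rmorphD (le_trans (ler_normB _ _))// lerD//.
  rewrite (le_trans (ler_normB _ _))// lerD//.
    by apply: HZ0; exact: leq_maxr.
  by apply: HM; exact: leq_maxr.
by apply: SZ => //; exact: leq_maxl.
Qed.

End EulerProduct.

(** * Quadratic irrationals in cyclotomic fields *)

Local Notation pQtoC := (map_poly (ratr : rat -> algC)).

Lemma root_neq0 n (x y : algC) : (0 < n)%N -> x ^+ n = y -> y != 0 -> x != 0.
Proof.
by move=> n0 xn; apply: contraNneq => x0; rewrite -xn x0 expr0n eqn0Ngt n0.
Qed.

Lemma aut_horner_rat (nu : {rmorphism algC -> algC}) (p : {poly rat}) x :
  nu (pQtoC p).[x] = (pQtoC p).[nu x].
Proof.
rewrite -horner_map -map_poly_comp; congr (_.[_]).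
by apply: eq_map_poly => c /=; rewrite fmorph_rat.
Qed.

(** Membership in the field [Q(z)], for an algebraic number [z]. *)
Definition in_adjoin (z x : algC) : Prop := exists p : {poly rat}, x = (pQtoC p).[z].

Section Adjoin.
Variable z : algC.
Local Notation K := (in_adjoin z).

Lemma in_adjoin_rat x : x \in Crat -> K x.
Proof. by move/CratP=> [r ->]; exists r%:P; rewrite map_polyC hornerC. Qed.

Lemma in_adjoin_id : K z.
Proof. by exists 'X; rewrite map_polyX hornerX. Qed.

Lemma in_adjoinB x y : K x -> K y -> K (x - y).
Proof. by move=> [p ->] [q ->]; exists (p - q); rewrite rmorphB hornerD hornerN. Qed.

Lemma in_adjoinM x y : K x -> K y -> K (x * y).
Proof. by move=> [p ->] [q ->]; exists (p * q); rewrite rmorphM hornerM. Qed.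

Lemma in_adjoinX x k : K x -> K (x ^+ k).
Proof. by move=> [p ->]; exists (p ^+ k); rewrite rmorphXn horner_exp. Qed.

Lemma in_adjoinZ_int (m : int) x : K x -> K (m%:~R * x).
Proof. by apply: in_adjoinM; apply/in_adjoin_rat/rpred_int. Qed.

Lemma in_adjoinN x : K x -> K (- x).
Proof. by move=> Kx; rewrite -mulN1r; exact: (in_adjoinZ_int (-1)). Qed.

Lemma in_adjoin_prod (I : Type) (s : seq I) (P : pred I) (F : I -> algC) :
  (forall i, K (F i)) -> K (\prod_(i <- s | P i) F i).
Proof.
move=> KF; elim/big_rec: _ => [|i x _]; first exact/in_adjoin_rat/rpred1.
exact: in_adjoinM.
Qed.

Lemma in_adjoin_aut (nu : {rmorphism algC -> algC}) x :
  nu z = z -> K x -> nu x = x.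
Proof.
by move=> nuz [p ->]; rewrite aut_horner_rat nuz.
Qed.

Lemma in_adjoin_trans w x : in_adjoin w z -> K x -> in_adjoin w x.
Proof.
move=> [p ->] [q ->]; exists (q \Po p).
by rewrite map_comp_poly horner_comp.
Qed.

End Adjoin.

(** Write [x] as a polynomial in [z] of degree less than that of the cyclotomic
    polynomial, which is [totient n].  If all automorphisms fix [x], this
    polynomial takes the value [x] at the [totient n] conjugates of [z], so it
    is constant. *)
Lemma fixed_adjoin_rat n z x : n.-primitive_root z -> in_adjoin z x ->
  (forall nu : {rmorphism algC -> algC}, nu x = x) -> x \in Crat.
Proof.
move=> pz [p Dx] nux; have n0 := prim_order_gt0 pz.
have [q [Dq q_mon q_dv]] := minCpolyP z.
have sq : size q = (totient n).+1.
  by rewrite -(size_cyclotomic z n) -(minCpoly_cyclotomic pz) Dq size_map_poly.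
pose r := p %% q.
have Dxr : x = (pQtoC r).[z].
  rewrite Dx {1}(divp_eq p q) rmorphD rmorphM hornerD hornerM /= -Dq.
  by rewrite (eqP (root_minCpoly z)) mulr0 add0r.
have sr : (size r <= totient n)%N by rewrite -ltnS -sq ltn_modp monic_neq0.
have t0 : (0 < totient n)%N by rewrite totient_gt0.
pose rs := [seq z ^+ k | k <- [seq k <- index_iota 0 n | coprime n k]].
have srs : size rs = totient n.
  rewrite size_map size_filter totient_count_coprime -sum1_count big_mkcond.
  by apply: eq_bigr => k _; case: coprime.
have urs : uniq rs.
  rewrite map_inj_in_uniq ?filter_uniq ?iota_uniq// => i j.
  rewrite !mem_filter !mem_index_iota => /andP[_ /= i_n] /andP[_ /= j_n] /eqP.
  by rewrite (eq_prim_root_expr pz) !modn_small// => /eqP.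
have rts : all (root (pQtoC r - x%:P)) rs.
  apply/allP => _ /mapP[k + ->]; rewrite mem_filter => /andP[nk _].
  have [nu nuE] := Qn_aut_exists (etrans (coprime_sym k n) nk).
  rewrite /root hornerD hornerN hornerC subr_eq0; apply/eqP.
  by rewrite -(nux nu) {1}Dxr aut_horner_rat nuE// (prim_expr_order pz).
have [|nz] := eqVneq (pQtoC r - x%:P) 0.
  move/eqP; rewrite subr_eq0 => /eqP/(congr1 (fun p : {poly algC} => p`_0)).
  by rewrite coefC /= coef_map /= => <-; apply: Crat_rat.
have := max_poly_roots nz rts urs; rewrite srs ltnNge (leq_trans (size_polyD _ _))//.
by rewrite geq_max size_map_poly sr size_polyN (leq_trans (size_polyC_leq1 _)).
Qed.

(** Pairing [j] with [p - j] in the product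
    [\prod_(1 <= j < p) (1 - w ^+ j) = p] turns it, up to the sign of the
    number of pairs, into a square: this is the quadratic Gauss sum in product
    form. *)
Lemma sqrt_pstar_exists p w : odd p -> p.-primitive_root w ->
  exists2 tau, in_adjoin w tau & tau ^+ 2 = (-1) ^+ p./2 * p%:R.
Proof.
move=> p_odd pw; set h := p./2.
have ph : p = h.*2.+1 by rewrite -{1}(odd_double_half p) p_odd.
have wp := prim_expr_order pw.
(* The order of [w] is odd, so [w] has a square root among its powers. *)
pose v := w ^+ h.+1.
have vv : v ^+ 2 = w.
  by rewrite -exprM muln2 doubleS -[h.*2.+2]addn1 -ph exprD wp mul1r expr1.
have vp : v ^+ p = 1 by rewrite -exprM mulnC exprM wp expr1n.
have prod1 : \prod_(1 <= j < p) (1 - w ^+ j) = p%:R :> algC.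
  have /(congr1 (fun q => q^`().[1])) : \prod_(0 <= i < p) ('X - (w ^+ i)%:P) = 'X^p - 1.
    exact: factor_Xn_sub_1.
  rewrite big_ltn; last by rewrite ph.
  rewrite expr0 derivM derivXsubC mul1r [('X^p - 1)^`()]derivB derivXn -polyC1 derivC.
  rewrite subr0 hornerD hornerM hornerXsubC subrr mul0r addr0 hornerMn hornerXn expr1n.
  by rewrite horner_prod => <-; apply: eq_bigr => j _; rewrite hornerXsubC.
exists (\prod_(1 <= j < h.+1) (v ^+ (p - j) * (1 - w ^+ j))).
  apply: in_adjoin_prod => j; apply: in_adjoinM; first exact/in_adjoinX/in_adjoinX/in_adjoin_id.
  by apply: in_adjoinB; [exact/in_adjoin_rat/rpred1|exact/in_adjoinX/in_adjoin_id].
rewrite -prodrXl.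
have -> : p%:R = (\prod_(1 <= j < h.+1) (1 - w ^+ j)) *
                 \prod_(1 <= j < h.+1) (1 - w ^+ (p - j)) :> algC.
  rewrite -prod1 (@big_cat_nat _ _ _ h.+1)//=; last by rewrite ph ltnS -addnn leq_addl.
  congr (_ * _); rewrite [RHS]big_nat_rev /=.
  have -> : \prod_(h.+1 <= i < p) (1 - w ^+ i) = \prod_(1 + h <= i < h.+1 + h) (1 - w ^+ i).
    by congr (\prod_(_ <= i < _) _); rewrite ?add1n// ph -addnn.
  rewrite big_addn addnK; apply: eq_big_nat => j /andP[j1 jh]; congr (1 - w ^+ _).
  by rewrite ph; lia.
rewrite -[h in (-1) ^+ h](subn1 h.+1) -prodr_const_nat -!big_split /=.
apply: eq_big_nat => j /andP[j1 jh].
have -> : w ^+ (p - j) = (v ^+ (p - j)) ^+ 2 by rewrite -exprM mulnC exprM vv.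
have wj : w ^+ j * v ^+ (p - j) ^+ 2 = 1.
  by rewrite -exprM mulnC exprM vv -exprD subnKC ?wp// ph; lia.
rewrite exprMn; move: wj; set x := w ^+ j; set y := v ^+ _ => wj; ring: wj.
Qed.

Lemma sqrt_in_adjoin z x s t : in_adjoin z s -> s ^+ 2 = x -> t ^+ 2 = x ->
  in_adjoin z t.
Proof.
move=> Ks <- /eqP; rewrite eqf_sqr => /orP[] /eqP -> //; exact: in_adjoinN.
Qed.

Lemma prim_root_half k (w : algC) : (k.*2).-primitive_root w -> w ^+ k = -1.
Proof.
move=> pw; have k0 : (0 < k)%N by rewrite -double_gt0 (prim_order_gt0 pw).
have /eqP : (w ^+ k) ^+ 2 = 1 by rewrite -exprM muln2 prim_expr_order.
rewrite sqrf_eq1 => /orP[|/eqP//].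
rewrite -(expr0 w) (eq_prim_root_expr pw) mod0n modn_small ?eqn0Ngt ?k0//.
by rewrite -addnn -{1}[k]addn0 ltn_add2l.
Qed.

Lemma pstar_mod4 p : odd p -> {j : int | (-1) ^+ p./2 * p%:Z = 1 + 4 * j}.
Proof.
move=> op; have := odd_double_half p; rewrite op => <-; set h := p./2.
have -> : (true + h.*2)./2 = h by rewrite half_bit_double.
have := odd_double_half h; case: (odd h) => <- /=; set k := h./2.
  by exists (- k.+1%:Z); rewrite -signr_odd /= odd_double /=; lia.
by exists k%:Z; rewrite -signr_odd /= odd_double /=; lia.
Qed.

(** For squarefree [m] this says that the discriminant of [Q(sqrt m)] divides
    [n]. *)
Definition conductor_dvd (m : int) (n : nat) : Prop :=
  [/\ forall p, prime p -> odd p -> (p %| `|m|)%N -> (p %| n)%N,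
      (m == 3 %[mod 4])%Z -> (4 %| n)%N & (2 %| `|m|)%N -> (8 %| n)%N].

(** By induction on the prime factors: every odd [p] contributes the square
    root of [p* = (-1) ^ ((p - 1) / 2) p], which is congruent to [1] modulo
    [4], so that only square roots of [-1] and [2] remain. *)
Lemma sqrt_in_cyclotomic (m : int) n z (t : algC) : m != 0 ->
  n.-primitive_root z -> conductor_dvd m n -> t ^+ 2 = m%:~R -> in_adjoin z t.
Proof.
move=> + pz; elim: {m}_.+1 {-2}m t (ltnSn `|m|%N) => // N IH m t mN m0 [mp m4 m8] tm.
(* A factor [x] of [m] whose square root [s] is known can be split off. *)
have step (x y : int) s : (`|y| < `|m|)%N -> m = x * y -> in_adjoin z s ->
    s ^+ 2 = x%:~R -> conductor_dvd y n -> in_adjoin z t.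
  move=> ym mxy Ks sx cy; apply: (@sqrt_in_adjoin _ m%:~R (s * sqrtC y%:~R)) => //.
    apply: in_adjoinM => //; apply: (IH y) => //; rewrite ?sqrtCK//.
      by rewrite (leq_trans ym).
    by apply: contraNneq m0 => y0; rewrite mxy y0 mulr0.
  by rewrite exprMn sqrtCK sx mxy rmorphM.
have [m_odd|/negbNE m_even] := boolP (~~ (2 %| `|m|)%N); last first.
  have n8 := m8 m_even; have pe := dvdn_prim_root pz n8.
  set y := z ^+ _ in pe; have y4 : y ^+ 4 = -1 by apply: prim_root_half.
  have m2E : m = 2 * (m %/ 2)%Z by lia.
(* [y^-1] is [- y ^+ 3], so this is the square root [y + y^-1] of [2]. *)
  apply: (@step 2 (m %/ 2)%Z (y - y ^+ 3)) => //.
  - by lia.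
  - by apply: in_adjoinB; do ?apply: in_adjoinX; exact: in_adjoin_id.
  - by ring: y4.
  split.
  - by move=> p pp op pm; apply: mp => //; rewrite m2E abszM dvdn_mull.
  - by move=> _; apply: dvdn_trans n8.
  - by [].
have [m1|m1] := leqP `|m|%N 1.
  have [mE|mE] : m = 1 \/ m = -1 by lia.
    apply: (@sqrt_in_adjoin _ 1 1); rewrite ?expr1n//; last by rewrite tm mE.
    exact/in_adjoin_rat/rpred1.
  have n4 : (4 %| n)%N by apply: m4; rewrite mE.
  have pe := dvdn_prim_root pz n4.
  apply: (@sqrt_in_adjoin _ (-1) (z ^+ (n %/ 4))); last by rewrite tm mE.
    exact/in_adjoinX/in_adjoin_id.
  by apply: prim_root_half.
pose p := pdiv `|m|%N.
have pp : prime p := pdiv_prime m1.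
have pm : (p %| `|m|)%N := pdiv_dvd _.
have op : odd p.
  by have [p2|//] := even_prime pp; case/negP: m_odd; rewrite -p2.
have [j jE] := pstar_mod4 op.
have [s Ks sp] := sqrt_pstar_exists op (dvdn_prim_root pz (mp p pp op pm)).
have [y mE] : {y | m = ((-1) ^+ p./2 * p%:Z) * y}.
  exists ((-1) ^+ p./2 * (m %/ p%:Z)%Z).
  by rewrite mulrACA -expr2 sqrr_sign mul1r mulrC divzK.
apply: (@step _ _ s _ mE).
- rewrite mE !abszM abszX exp1n !mul1n absz_nat ltn_Pmull ?(prime_gt1 pp)//.
  by rewrite absz_gt0; apply: contraNneq m0 => y0; rewrite mE y0 mulr0.
- by apply: in_adjoin_trans Ks; exact/in_adjoinX/in_adjoin_id.
- by rewrite sp rmorphM rmorphXn rmorphN1.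
split.
- by move=> q qp oq qy; apply: mp => //; rewrite mE abszM dvdn_mull.
- by rewrite jE in mE => y3; apply: m4; rewrite mE; lia.
- by move=> y2; case/negP: m_odd; rewrite mE abszM dvdn_mull.
Qed.

Lemma sqr_eq_opp (x y : algC) : x ^+ 2 = y ^+ 2 -> x != y -> x = - y.
Proof. by move/eqP; rewrite eqf_sqr => /orP[/eqP->|/eqP//]; rewrite eqxx. Qed.

(** A root of an integer is an algebraic integer. *)
Lemma rat_root_int n (x : algC) : (0 < n)%N -> x \in Crat ->
  x ^+ n \in Num.int -> x \in Num.int.
Proof.
move=> n0 xQ /intrP[c xc]; apply: Cint_rat_Aint => //.
apply: (@root_monic_Aint ('X^n - (c%:~R)%:P)).
- by rewrite /root !hornerE xc subrr.
- exact: monicXnsubC.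
- apply/polyOverP => i; rewrite coefB coefXn coefC.
  by case: ifP => _; rewrite rpredB ?rpred_nat ?rpred_int ?rpred0.
Qed.

Lemma coprime_sqr_prime_irrational (p : nat) (s : algC) (b : int) :
  prime p -> `|b|%N = p -> s ^+ 2 = b%:~R -> s \notin Crat.
Proof.
move=> pp bp sb; apply/negP => sQ.
have /intrP[c sc] : s \in Num.int by apply: (@rat_root_int 2); rewrite ?sb ?rpred_int.
have /(congr1 (logn p)) : (`|c| ^ 2)%N = p.
  rewrite -abszX -bp; congr (absz _); apply: (@intr_inj algC).
  by rewrite rmorphXn -sb sc.
by rewrite lognX (logn_prime p pp) eqxx; lia.
Qed.

Definition sqfree (m : int) : Prop := forall p, prime p -> ~~ (p ^ 2 %| `|m|)%N.

Lemma aut_fix_unity_root (nu : {rmorphism algC -> algC}) M u D w :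
  (forall w, w ^+ M = 1 -> nu w = w ^+ u) -> (D %| M)%N -> u = 1 %[mod D] ->
  w ^+ D = 1 -> nu w = w.
Proof.
move=> nuE DM uD wD; rewrite nuE; last by rewrite -(divnK DM) mulnC exprM wD expr1n.
by rewrite -(expr_mod _ wD) uD expr_mod ?expr1.
Qed.

Lemma aut_fix_sqrt (nu : {rmorphism algC -> algC}) M u D (m : int) t :
  (forall w, w ^+ M = 1 -> nu w = w ^+ u) -> (D %| M)%N -> u = 1 %[mod D] ->
  (0 < D)%N -> m != 0 -> conductor_dvd m D -> t ^+ 2 = m%:~R -> nu t = t.
Proof.
move=> nuE DM uD D0 m0 mD tm; have [z pz] := C_prim_root_exists D0.
apply: (@in_adjoin_aut z); last exact: (sqrt_in_cyclotomic m0 pz mD tm).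
by apply: (aut_fix_unity_root nuE DM uD); exact: (prim_expr_order pz).
Qed.

(** Write [m = p* m'] with [p* = (-1) ^ ((p - 1) / 2) p].  The square root of
    [p*] is irrational and lies in the field of [p]-th roots of unity, so some
    automorphism moves it.  By the Chinese remainder theorem its action on
    [p]-th roots of unity can be combined with the trivial action on roots of
    unity of order [N] and on those that generate a field containing [sqrt m']. *)
Lemma flip_odd (m : int) p N t : sqfree m -> m != 0 -> prime p -> odd p ->
  (p %| `|m|)%N -> (0 < N)%N -> ~~ (p %| N)%N -> t ^+ 2 = m%:~R ->
  exists2 nu : {rmorphism algC -> algC},
    forall w, w ^+ N = 1 -> nu w = w & nu t = - t.
Proof.
move=> sqm m0 pp op pm N0 pN tm; have p0 := prime_gt0 pp.
have [w pw] := C_prim_root_exists p0.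
have [s [P Ks] sp] := sqrt_pstar_exists op pw.
have sQ : s \notin Crat.
  apply: (@coprime_sqr_prime_irrational _ _ ((-1) ^+ p./2 * p%:Z) pp).
    by rewrite abszM abszX exp1n mul1n absz_nat.
  by rewrite sp rmorphM rmorphXn rmorphN1.
have [nu /eqP nus] : exists nu : {rmorphism algC -> algC}, nu s <> s.
  apply/not_existsP => H; case/negP: sQ.
  by apply: (fixed_adjoin_rat pw) => [|nu]; [exists P|exact: contrapT].
have /(prim_rootP pw)[k wk] : nu w ^+ p = 1.
  by rewrite -rmorphXn (prim_expr_order pw) rmorph1.
have [m' mE] : {m' | m = ((-1) ^+ p./2 * p%:Z) * m'}.
  exists ((-1) ^+ p./2 * (m %/ p%:Z)%Z).
  by rewrite mulrACA -expr2 sqrr_sign mul1r mulrC divzK.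
have m'0 : m' != 0 by apply: contraNneq m0 => y0; rewrite mE y0 mulr0.
have pm' : ~~ (p %| `|m'|)%N.
  apply: contra (sqm p pp) => pm'.
  by rewrite mE !abszM abszX exp1n mul1n absz_nat expnS dvdn_mul// expn1.
pose D := (N * (8 * `|m'|))%N.
have D0 : (0 < D)%N by rewrite !muln_gt0 N0 absz_gt0.
have cpD : coprime p D.
  rewrite prime_coprime// !Euclid_dvdM// !negb_or pN pm' andbT /=.
  by rewrite -prime_coprime// (@coprimeXr 3 p 2)// coprimen2.
have ck : coprime k p.
  rewrite coprime_sym prime_coprime//; apply/negP => pk.
  have : nu w = nu 1 by rewrite wk rmorph1; apply/eqP; rewrite -(prim_order_dvd pw).
  move/fmorph_inj => w1; have := prim_order_dvd pw 1.
  by rewrite w1 expr1 eqxx dvdn1 => /eqP p1; move: pp; rewrite p1.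
have cu : coprime (chinese p D k 1) (p * D).
  rewrite coprimeMr -[coprime _ p]coprime_modl -[coprime _ D]coprime_modl.
  by rewrite chinese_modl// chinese_modr// !coprime_modl ck coprime1n.
(* [mu] acts as [nu] on [p]-th roots of unity and trivially on [D]-th ones. *)
have [mu muE] := Qn_aut_exists cu.
exists mu => [x xN|].
  by apply: (aut_fix_unity_root muE (dvdn_mull _ (dvdnn D)) (chinese_modr cpD _ _));
     rewrite exprM xN expr1n.
have muw : mu w = nu w.
  rewrite muE ?exprM ?(prim_expr_order pw) ?expr1n// wk.
  by apply/eqP; rewrite (eq_prim_root_expr pw) chinese_modl.
have mus : mu s = - s.
  apply: sqr_eq_opp.
    by rewrite -rmorphXn sp rmorphM rmorphXn rmorphN1 rmorph_nat.
  suff -> : mu s = nu s by [].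
  by rewrite Ks !aut_horner_rat muw.
have mut : mu (sqrtC m'%:~R) = sqrtC m'%:~R.
  apply: (aut_fix_sqrt muE (dvdn_mull _ (dvdnn D)) (chinese_modr cpD _ _) D0 m'0).
    split=> [q _ _ qm'|_|_]; rewrite /D dvdn_mull//; do 1?[exact: dvdn_mull | exact: dvdn_mulr].
  exact: sqrtCK.
have /eqP : t ^+ 2 = (s * sqrtC m'%:~R) ^+ 2.
  by rewrite exprMn sqrtCK sp tm {1}mE !rmorphM rmorphXn rmorphN1.
by rewrite eqf_sqr => /orP[]/eqP ->; rewrite ?rmorphN rmorphM mus mut ?mulNr.
Qed.

(** As [- m] is congruent to [1] modulo [4], its square root lies in a field of
    roots of unity of odd order, and the factor [sqrt (-1)] of [sqrt m] can be
    moved independently. *)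
Lemma flip_four (m : int) N t : m != 0 -> (m == 3 %[mod 4])%Z -> odd N ->
  t ^+ 2 = m%:~R ->
  exists2 nu : {rmorphism algC -> algC},
    forall w, w ^+ (2 * N) = 1 -> nu w = w & nu t = - t.
Proof.
move=> m0 m3 oN tm.
have om : odd `|m|%N by lia.
have N0 : (0 < N)%N by case: N oN.
pose D := (N * `|m|)%N.
have oD : odd D by rewrite oddM oN.
have D0 : (0 < D)%N by rewrite muln_gt0 N0 absz_gt0.
have c4 : coprime 4 D by rewrite (@coprimeXl 2 2)// coprime2n.
pose u := chinese 4 D 3 1.
have u4 : u = 3 %[mod 4] by exact: chinese_modl.
have uD : u = 1 %[mod D] by exact: chinese_modr.
have cu : coprime u (4 * D).
  rewrite coprimeMr -[coprime _ 4]coprime_modl -[coprime _ D]coprime_modl.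
  by rewrite u4 uD !coprime_modl coprime1n.
have [mu muE] := Qn_aut_exists cu.
have [i i2] : {i : algC | i ^+ 2 = -1} by exists (sqrtC (-1)); exact: sqrtCK.
have mui : mu i = - i.
  have i4 : i ^+ 4 = 1 by rewrite (exprM i 2 2) i2 sqrrN expr1n.
  by rewrite muE ?exprM ?i4 ?expr1n// -(expr_mod _ i4) u4 (expr_mod _ i4) exprS i2 mulrN1.
have mut : mu (sqrtC (- m)%:~R) = sqrtC (- m)%:~R.
  apply: (@aut_fix_sqrt _ _ _ D (- m) _ muE (dvdn_mull _ (dvdnn D)) uD D0).
  - by rewrite oppr_eq0.
  - split; rewrite ?abszN.
    + by move=> q _ _ qm; rewrite dvdn_mull.
    + by lia.
    + by rewrite dvdn2 om.
  - exact: sqrtCK.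
exists mu => [w wN|].
  apply: (@aut_fix_unity_root mu _ u (2 * N) w muE) => //.
    by rewrite -[4%N]/(2 * 2)%N mulnACA dvdn_mulr.
  apply/eqP; rewrite chinese_remainder ?coprime2n//; apply/andP; split; apply/eqP.
    by rewrite -(modn_dvdm u (_ : 2 %| 4)%N) ?u4.
  by rewrite -(modn_dvdm u (dvdn_mulr `|m|%N (dvdnn N))) uD modn_dvdm// dvdn_mulr.
have /eqP : t ^+ 2 = (i * sqrtC (- m)%:~R) ^+ 2.
  by rewrite exprMn sqrtCK i2 tm rmorphN mulrNN mul1r.
move: mut; set s := sqrtC _ => mut.
by rewrite eqf_sqr => /orP[]/eqP ->; rewrite ?rmorphN rmorphM mui mut ?mulNr.
Qed.

(** For even squarefree [m] the square root of [m / 2] lies in a field of roots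
    of unity of order [4] times an odd number.  Raising 8-th roots of unity to
    the power [5] fixes the 4-th ones and moves the factor [sqrt 2] of
    [sqrt m]. *)
Lemma flip_eight (m : int) N t : sqfree m -> m != 0 -> (2 %| `|m|)%N -> odd N ->
  t ^+ 2 = m%:~R ->
  exists (nu : {rmorphism algC -> algC}) (u : nat),
    [/\ u = 5 %[mod 8], u = 1 %[mod N],
        forall w, w ^+ (8 * N) = 1 -> nu w = w ^+ u & nu t = - t].
Proof.
move=> sqm m0 m2 oN tm.
have [m' mE] : {m' | m = 2 * m'} by exists (m %/ 2)%Z; lia.
have om : odd `|m'|%N by have := sqm 2%N isT; rewrite mE; lia.
have m'0 : m' != 0 by lia.
have N0 : (0 < N)%N by case: N oN.
pose D := (N * `|m'|)%N.
have oD : odd D by rewrite oddM oN.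
have c8 : coprime 8 D by rewrite (@coprimeXl 3 2)// coprime2n.
pose u := chinese 8 D 5 1.
have u8 : u = 5 %[mod 8] by exact: chinese_modl.
have uD : u = 1 %[mod D] by exact: chinese_modr.
have uN : u = 1 %[mod N].
  by rewrite -(modn_dvdm u (dvdn_mulr `|m'|%N (dvdnn N))) uD modn_dvdm// dvdn_mulr.
have cu : coprime u (8 * D).
  rewrite coprimeMr -[coprime _ 8]coprime_modl -[coprime _ D]coprime_modl.
  by rewrite u8 uD !coprime_modl coprime1n.
have [mu muE] := Qn_aut_exists cu.
have [y py] : {y : algC | 8.-primitive_root y} by exact: C_prim_root_exists.
have y4 : y ^+ 4 = -1 by exact: (@prim_root_half 4).
have y8 := prim_expr_order py.
have muy : mu y = - y.
  by rewrite muE ?exprM ?y8 ?expr1n// -(expr_mod _ y8) u8 (expr_mod _ y8) exprS y4 mulrN1.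
have s2 : (y - y ^+ 3) ^+ 2 = 2 by ring: y4.
have mus : mu (y - y ^+ 3) = - (y - y ^+ 3) by rewrite rmorphB rmorphXn muy; ring.
have mut : mu (sqrtC m'%:~R) = sqrtC m'%:~R.
  apply: (@aut_fix_sqrt mu _ u (4 * `|m'|) m' _ muE) => //.
  - by rewrite /D [(N * _)%N]mulnC -[8%N]/(4 * 2)%N mulnACA dvdn_mulr.
  - apply/eqP; rewrite chinese_remainder ?(@coprimeXl 2 2) ?coprime2n//.
    apply/andP; split; apply/eqP; first by rewrite -(modn_dvdm u (_ : 4 %| 8)%N) ?u8.
    rewrite -(modn_dvdm u (dvdn_mull N (dvdnn `|m'|%N))) uD modn_dvdm//.
    by rewrite dvdn_mull.
  - by rewrite muln_gt0 absz_gt0.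
  - split; last by rewrite dvdn2 om.
    + by move=> q _ _ qm; rewrite dvdn_mull.
    + by move=> _; rewrite dvdn_mulr.
  - exact: sqrtCK.
exists mu, u; split=> // [w wN|].
  by apply: muE; rewrite /D mulnA exprM wN expr1n.
have /eqP : t ^+ 2 = ((y - y ^+ 3) * sqrtC m'%:~R) ^+ 2.
  by rewrite exprMn sqrtCK s2 tm mE rmorphM.
by rewrite eqf_sqr => /orP[]/eqP ->; rewrite ?rmorphN rmorphM mus mut ?mulNr.
Qed.

Lemma opp_eq_sqrt_absurd (m : int) (t : algC) : m != 0 -> t ^+ 2 = m%:~R ->
  - t = t -> False.
Proof.
move=> m0 tm /eqP; rewrite -subr_eq0 -opprD oppr_eq0 -mulr2n mulrn_eq0 /= => /eqP t0.
by move: tm; rewrite t0 expr0n /= => /esym/eqP; rewrite intr_eq0 (negbTE m0).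
Qed.

Lemma unity_root_mul n k (w : algC) : w ^+ n = 1 -> (n %| k)%N -> w ^+ k = 1.
Proof. by move=> wn /dvdnP[c ->]; rewrite mulnC exprM wn expr1n. Qed.

Lemma two_part_dvd n k : (0 < n)%N -> ~~ (2 ^ k.+1 %| n)%N ->
  (n %| 2 ^ k * n`_2^')%N.
Proof.
move=> n0; rewrite pfactor_dvdn// -ltnNge ltnS => nk.
by rewrite -{1}(partnC 2%N n0) dvdn_mul// p_part dvdn_exp2l.
Qed.

Lemma odd_2part n : odd (n`_2^')%N.
Proof. by rewrite -coprime2n coprime_sym (pnat_coprime (part_pnat _ _)) ?pnat_id. Qed.

(** When the discriminant does not divide [n], one of the three automorphisms
    above fixes [z] and moves [sqrt m]. *)
Lemma sqrt_in_cyclotomicP (m : int) n z (t : algC) : sqfree m -> m != 0 ->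
  n.-primitive_root z -> t ^+ 2 = m%:~R ->
  in_adjoin z t <-> conductor_dvd m n.
Proof.
move=> sqm m0 pz tm; split=> [Kt|]; last by move=> c; exact: (sqrt_in_cyclotomic m0 pz c tm).
have n0 := prim_order_gt0 pz; have zn := prim_expr_order pz.
split=> [p pp op pm|m3|m2]; apply: contrapT => /negP ndv.
- have [nu nuE nut] := flip_odd sqm m0 pp op pm n0 ndv tm.
  apply: (opp_eq_sqrt_absurd m0 tm).
  by rewrite -nut; apply: in_adjoin_aut Kt; exact: nuE.
- have [nu nuE nut] := flip_four m0 m3 (odd_2part n) tm.
  apply: (opp_eq_sqrt_absurd m0 tm).
  rewrite -nut; apply: in_adjoin_aut Kt; apply/nuE/(unity_root_mul zn).
  exact: (@two_part_dvd n 1).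
- have [nu [u [u8 uN nuE nut]]] := flip_eight sqm m0 m2 (odd_2part n) tm.
  apply: (opp_eq_sqrt_absurd m0 tm).
  have n4 : (n %| 4 * n`_2^')%N by exact: (@two_part_dvd n 2).
  rewrite -nut; apply: in_adjoin_aut Kt; apply: (aut_fix_unity_root nuE) zn.
    by rewrite (dvdn_trans n4)// dvdn_pmul2r ?part_gt0.
  rewrite -(modn_dvdm u n4).
  have -> : (u %% (4 * n`_2^') = 1 %% (4 * n`_2^'))%N.
    apply/eqP; rewrite chinese_remainder ?(@coprimeXl 2 2) ?coprime2n ?odd_2part//.
    by apply/andP; split; apply/eqP; rewrite // -(modn_dvdm u (_ : 4 %| 8)%N) ?u8.
  by rewrite modn_dvdm.
Qed.

(** Adjoining [om] to [Q(z)] gives the field of [2 n]-th roots of unity.  It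
    contains the square root of an integer that is not in [Q(z)] only if [n] is
    [4] times an odd number.  Up to a factor in [Q(z)] this is then [sqrt 2],
    and [om * sqrt 2] lies in [Q(z)], as in the identity
    [z8 * (z8 + z8^-1) = z8 ^ 2 + 1] for an 8-th root of unity [z8].  In all
    other cases an automorphism that fixes [z] changes the sign of exactly one
    of [om] and [t]. *)
Lemma twisted_sqrt_in_cyclotomicP (m : int) n z (om t : algC) :
  sqfree m -> m != 0 -> n.-primitive_root z -> (4 %| n)%N -> om ^+ n = -1 ->
  t ^+ 2 = m%:~R ->
  in_adjoin z (om * t) <->
  [/\ forall p, prime p -> odd p -> (p %| `|m|)%N -> (p %| n)%N,
      (2 %| `|m|)%N & ~~ (8 %| n)%N].
Proof.
move=> sqm m0 pz n4 omn tm.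
have n0 := prim_order_gt0 pz; have zn := prim_expr_order pz.
have om2n : om ^+ (2 * n) = 1 by rewrite mulnC exprM omn sqrrN expr1n.
have om0 : om != 0.
  by apply: (root_neq0 n0 omn); rewrite oppr_eq0 oner_eq0.
have absurd (nu : {rmorphism algC -> algC}) : in_adjoin z (om * t) ->
    nu z = z -> (nu om = om /\ nu t = - t) \/ (nu om = - om /\ nu t = t) -> False.
  move=> K nuz H; apply: (opp_eq_sqrt_absurd m0 tm).
  apply: (mulfI om0); rewrite -[RHS](in_adjoin_aut nuz K) rmorphM.
  by case: H => -[-> ->]; rewrite ?mulNr ?mulrN.
split=> [Kt|[mp m2 n8]].
  have mp p : prime p -> odd p -> (p %| `|m|)%N -> (p %| n)%N.
    move=> pp op pm; apply: contrapT => /negP ndv.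
    have p2n : ~~ (p %| 2 * n)%N.
      rewrite Euclid_dvdM// negb_or ndv andbT dvdn_prime2//.
      by apply: contraTneq op => ->.
    have [|nu nuE nut] := flip_odd sqm m0 pp op pm _ p2n tm.
      by rewrite muln_gt0.
    by apply: (absurd nu Kt); [apply: nuE; rewrite mulnC exprM zn expr1n|left; rewrite nuE].
  suff /andP[] : (2 %| `|m|)%N && ~~ (8 %| n)%N by split.
  apply: contrapT => /negP; rewrite negb_and negbK => m2n8.
  (* As [k] is odd, raising to the power [n * k + 1] negates [om]; it fixes the
     roots of unity of order [n * k], which generate a field containing [t]. *)
  pose am := `|m|%N; pose k := (am`_2^')%N; pose D := (n * k)%N.
  have k0 : (0 < k)%N by rewrite part_gt0.
  have D0 : (0 < D)%N by rewrite muln_gt0 n0.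
  have eD : ~~ odd D by rewrite oddM negb_and; apply/orP; left; lia.
  have cu : coprime D.+1 (2 * D).
    by rewrite coprimeMr coprimen2 /= eD coprimeSn.
  have [nu nuE] := Qn_aut_exists cu.
  have D1 : D.+1 = 1 %[mod D] by rewrite -addn1 modnDl.
  apply: (absurd nu Kt).
    apply: (aut_fix_unity_root nuE) zn; first by rewrite dvdn_mull// dvdn_mulr.
    by rewrite -addn1 -modnDm modnMr add0n modn_mod.
  right; split.
    rewrite nuE; last by rewrite mulnA exprM om2n expr1n.
    by rewrite exprS exprM omn -signr_odd odd_2part mulrN1.
  apply: (aut_fix_sqrt nuE (dvdn_mull _ (dvdnn D)) D1 D0 m0) tm.
  split.
  - by move=> p pp op pm; rewrite dvdn_mulr ?mp.
  - by move=> _; rewrite dvdn_mulr.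
  - by move=> m2; rewrite m2 /= in m2n8; rewrite dvdn_mulr.
have [m' mE] : {m' | m = 2 * m'} by exists (m %/ 2)%Z; lia.
have om' : odd `|m'|%N by have := sqm 2%N isT; rewrite mE; lia.
have m'0 : m' != 0 by lia.
pose N := (n %/ 4)%N; have nE : n = (N * 4)%N by rewrite divnK.
have oN : odd N by lia.
have Kt' : in_adjoin z (sqrtC m'%:~R).
  apply: (sqrt_in_cyclotomic m'0 pz); last exact: sqrtCK.
  split=> //; last by rewrite dvdn2 om'.
  by move=> p pp op pm; apply: mp => //; rewrite mE abszM dvdn_mull.
have [i omi] : exists i, om ^+ 2 = z ^+ i.
  have /(prim_rootP pz)[i ->] : (om ^+ 2) ^+ n = 1 by rewrite -exprM.
  by exists i.
(* [om ^+ N] is a primitive 8-th root of unity, and [s] is a square root of [2]. *)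
pose s := om ^+ N - om ^+ (3 * N).
have s2 : s ^+ 2 = 2.
  have y4 : (om ^+ N) ^+ 4 = -1 by rewrite -exprM -nE.
  by rewrite /s mulnC exprM; ring: y4.
have Kos : in_adjoin z (om * s).
  rewrite /s mulrBr -!exprS.
  have even k : ~~ odd k -> in_adjoin z (om ^+ k).
    move=> ek; rewrite -(odd_double_half k) (negbTE ek) add0n -mul2n exprM omi.
    exact/in_adjoinX/in_adjoinX/in_adjoin_id.
  by apply: in_adjoinB; apply: even; rewrite /= ?oddM oN.
apply: (@sqrt_in_adjoin _ (om ^+ 2 * m%:~R) (om * s * sqrtC m'%:~R)).
- exact: in_adjoinM.
- by rewrite !exprMn sqrtCK s2 mE rmorphM mulrA.
- by rewrite exprMn tm.
Qed.

(** * The discriminant of a quadratic field *)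

(** By the Cayley-Hamilton theorem [\tr M *: M] is scalar. *)
Lemma mx22_trace0 n (M : 'M[rat]_n) (c : rat) : n = 2%N ->
  M *m M = c%:M -> (forall d, M <> d%:M) -> \tr M = 0.
Proof.
move=> n2; subst n => MM Mns; apply/eqP; apply: contrapT => /negP tr0.
have E i j : \sum_k M i k * M k j = c *+ (i == j).
  by move/matrixP: MM => /(_ i j); rewrite !mxE.
move: tr0; rewrite /mxtrace big_ord_recl big_ord1 => tr0.
set i0 : 'I_2 := ord0 in tr0 *; set i1 : 'I_2 := lift ord0 ord0 in tr0 *.
have := E i0 i1; have := E i1 i0; have := E i0 i0; have := E i1 i1.
rewrite !big_ord_recl !big_ord0 !addr0 -/i0 -/i1 /=.
rewrite ?mulr0n ?mulr1n => E11 E00 E10 E01.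
have M01 : M i0 i1 = 0 by apply: (mulfI tr0); rewrite mulr0 -E01; ring.
have M10 : M i1 i0 = 0 by apply: (mulfI tr0); rewrite mulr0 -E10; ring.
have M11 : M i1 i1 = M i0 i0.
  apply: (mulfI tr0); apply/eqP; rewrite -subr_eq0; apply/eqP.
  transitivity ((M i1 i0 * M i0 i1 + M i1 i1 * M i1 i1) -
                (M i0 i0 * M i0 i0 + M i0 i1 * M i1 i0)); first by ring.
  by rewrite E11 E00 subrr.
apply: (Mns (M i0 i0)); apply/matrixP => i j; rewrite mxE.
have ord2 (k : 'I_2) : k = i0 \/ k = i1.
  by case: k => [[|[|//]] ?]; [left|right]; exact: val_inj.
by case: (ord2 i) (ord2 j) => -> [] ->; rewrite ?M01 ?M10 ?M11 ?eqxx ?mulr0n ?mulr1n.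
Qed.

Section Trace.
Import passmx.
Variable K : fieldExtType rat.

Lemma field_trace_is_linear (k : rat) (x y : K) :
  field_trace (k *: x + y) = k * field_trace x + field_trace y.
Proof.
rewrite /field_trace.
have -> : amulr (k *: x + y) = k *: amulr x + amulr y by rewrite linearP.
by rewrite linearP /= mxtraceD mxtraceZ.
Qed.

Lemma field_traceD (x y : K) : field_trace (x + y) = field_trace x + field_trace y.
Proof. by have := field_trace_is_linear 1 x y; rewrite scale1r mul1r. Qed.

Lemma field_trace0 : field_trace (0 : K) = 0.
Proof. by rewrite /field_trace !linear0. Qed.

Lemma field_traceZ k (x : K) : field_trace (k *: x) = k * field_trace x.
Proof.
by have := field_trace_is_linear k x 0; rewrite addr0 field_trace0 addr0.
Qed.

Lemma field_trace1 : field_trace (1 : K) = (\dim {:K})%:R.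
Proof.
have -> : field_trace (1 : K) = \tr (1%:M : 'M[rat]_(\dim {:K})).
  rewrite /field_trace -(mxof1 (basis_free (vbasisP _))).
  by congr (\tr (mxof _ _ _)); apply/lfunP => v; rewrite !lfunE /= mulr1.
by rewrite mxtrace1.
Qed.

(** Multiplication by [s] is not a scalar, but its square is. *)
Lemma field_trace_sqrt (s : K) (c : rat) : \dim {:K} = 2%N ->
  s ^+ 2 = c%:A -> (forall d : rat, s <> d%:A) -> field_trace s = 0.
Proof.
move=> dK ss sns; have vB := vbasisP {:K}.
apply: (@mx22_trace0 _ _ c dK).
  rewrite -mxof_comp//.
  rewrite -scalemx1 -(mxof1 (basis_free vB)) -linearZ /=.
  congr (mxof _ _ _); apply/lfunP => v; rewrite !lfunE /= !lfunE /=.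
  by rewrite -mulrA -expr2 ss mulr_algr.
move=> d Md; apply: (sns d).
have /(can_inj (mxofK vB vB)) sd : mxof (vbasis {:K}) (vbasis {:K}) (amulr s) =
    mxof (vbasis {:K}) (vbasis {:K}) (d *: \1%VF).
  by rewrite Md linearZ /= mxof1 ?(basis_free vB)// scalemx1.
by have /lfunP/(_ 1) := sd; rewrite !lfunE /= !lfunE /= mul1r.
Qed.

End Trace.

(** The coefficients [A] and [B] depend neither on the field nor on the choice
    of the square root, so that an equation satisfied by an element of an
    abstract quadratic field also holds for both of its conjugates in [algC]. *)
Lemma horner_quadratic (m u v : rat) (p : {poly rat}) : exists A B : rat,
  forall (L : fieldType) (f : {rmorphism rat -> L}) (s : L), s ^+ 2 = f m ->
    (map_poly f p).[f u + f v * s] = f A + f B * s.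
Proof.
elim/poly_ind: p => [|p c [A [B E]]].
  by exists 0, 0 => L f s _; rewrite !rmorph0 horner0 mul0r addr0.
exists (A * u + B * v * m + c), (A * v + B * u) => L f s sm.
rewrite rmorphD rmorphM /= map_polyX map_polyC hornerMXaddC (E L f s sm) /=.
by rewrite !rmorphD !rmorphM -sm; ring.
Qed.

Lemma sqfree_square_mul (m k A : int) : sqfree m -> m != 0 ->
  A ^+ 2 = m * k -> (m %| A)%Z.
Proof.
move=> sqm m0 E.
have [A0|A0] := eqVneq A 0; first by rewrite A0 dvdz0.
have k0 : k != 0.
  by apply: contraNneq A0 => k0; move/eqP: E; rewrite k0 mulr0 sqrf_eq0.
rewrite dvdzE; apply/dvdn_partP; rewrite ?absz_gt0// => p.
rewrite mem_primes => /and3P[pp _ pm].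
have {E}: (`|A| ^ 2 = `|m| * `|k|)%N by rewrite -abszX E abszM.
move/(congr1 (logn p)); rewrite lognX lognM ?absz_gt0// => E.
rewrite p_part pfactor_dvdn ?absz_gt0//.
have : (logn p `|m| < 2)%N.
  by rewrite ltnNge -pfactor_dvdn ?absz_gt0//; exact: sqm.
by case: (logn p `|m|%N) E => [|[|//]] /=; lia.
Qed.

Lemma sqfree_rat_int (m : int) (v : rat) : sqfree m -> m != 0 ->
  m%:~R * v ^+ 2 \is a Num.int -> v \is a Num.int.
Proof.
move=> sqm m0 /intrP[k kE].
have mv : (ratr (m%:~R * v) : algC) \in Num.int.
  apply: (@rat_root_int 2) => //; first exact: Crat_rat.
  rewrite -rmorphXn exprMn expr2 -mulrA kE rmorphM !rmorph_int.
  by rewrite rpredM ?rpred_int.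
rewrite Cint_rat in mv; have /intrP[A AE] := mv.
have /(sqfree_square_mul sqm m0)/dvdzP[c cE] : A ^+ 2 = m * k.
  by apply: (@intr_inj rat); rewrite rmorphXn rmorphM /= -AE -kE; ring.
apply/intrP; exists c; apply: (@mulfI _ m%:~R); first by rewrite intr_eq0.
by rewrite AE cE rmorphM mulrC.
Qed.

Definition quadratic_disc (m : int) : int := if (m == 1 %[mod 4])%Z then m else 4 * m.

Section QuadraticField.
Variables (K : fieldExtType rat) (s : K) (m : int).
Hypothesis sqm : sqfree m.
Hypothesis m1 : m != 1.
Hypothesis m0 : m != 0.
Hypothesis sm : s ^+ 2 = m%:~R.
Hypothesis Ks : <<1; s>>%VS = {:K}%VS.

Lemma int_alg (k : int) : k%:~R = k%:~R%:A :> K.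
Proof. by rewrite -[RHS]/(in_alg K k%:~R) rmorph_int. Qed.

Lemma quadratic_irrational (d : rat) : s <> d%:A.
Proof.
move=> sd; have d2 : d ^+ 2 = m%:~R.
  apply: (fmorph_inj (in_alg K)).
  by rewrite [RHS]rmorph_int -sm sd rmorphXn.
have /intrP[c cE] : d \is a Num.int.
  rewrite -Cint_rat; apply: (@rat_root_int 2) => //; first exact: Crat_rat.
  by rewrite -rmorphXn d2 rmorph_int rpred_int.
have cm : c ^+ 2 = m by apply: (@intr_inj rat); rewrite rmorphXn -d2 cE.
have /dvdzP[k kE] : (m %| c)%Z by apply: (@sqfree_square_mul _ 1); rewrite ?mulr1.
have : (k ^+ 2 * m - 1) * m = 0.
  by transitivity ((k * m) ^+ 2 - m); [ring|rewrite -kE cm subrr].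
move/eqP; rewrite mulf_eq0 (negbTE m0) orbF subr_eq0 => /eqP km.
have : (`|m| %| absz (k ^+ 2 * m)%R)%N by rewrite abszM dvdn_mull.
by rewrite km dvdn1 => /eqP m1'; have := sqr_ge0 c; lia.
Qed.

Lemma quadratic_coord (x : K) : exists u v : rat, x = u%:A + v%:A * s.
Proof.
have : x \in <<1; s>>%VS by rewrite Ks memvf.
move=> /Fadjoin_polyP[p pK ->].
have [q ->] : exists q, p = map_poly (in_alg K) q.
  exact/polyOver1P.
have [A [B E]] := horner_quadratic m%:~R 0 1 q.
exists A, B; have := E K (in_alg K) s; rewrite rmorph0 rmorph1 add0r mul1r; apply.
by rewrite sm [RHS]rmorph_int.
Qed.

Lemma quadratic_coord_eq0 (u v : rat) : u%:A + v%:A * s = 0 -> u = 0 /\ v = 0.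
Proof.
move=> E; have v0 : v = 0.
  apply: contrapT => /eqP v0; apply: (@quadratic_irrational (- u / v)).
  have fv0 : in_alg K v != 0 by rewrite fmorph_eq0.
  apply: (mulfI fv0); rewrite -[(- u / v)%:A]/(in_alg K (- u / v)) -rmorphM.
  rewrite [v * _]mulrC divfK// rmorphN; apply/eqP.
  by rewrite -subr_eq0 opprK addrC; apply/eqP.
split=> //; move/eqP: E; rewrite v0 scale0r mul0r addr0.
by rewrite -[u%:A]/(in_alg K u) fmorph_eq0 => /eqP.
Qed.

Lemma quadratic_dim : \dim {:K} = 2%N.
Proof.
suff bK : basis_of {:K} [tuple 1; s] by rewrite -(size_basis bK).
apply/andP; split.
  rewrite eqEsubv subvf; apply/subvP => x _.
  have [u [v ->]] := quadratic_coord x.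
  by rewrite mulr_algl memvD// memvZ// memv_span// !inE eqxx ?orbT.
apply/freeP => k; rewrite !big_ord_recl big_ord0 addr0 /=.
rewrite -[X in _ + X]mulr_algl => /quadratic_coord_eq0[k0 k1] i.
by case: i => [[|[|//]] ?]; [rewrite -[RHS]k0|rewrite -[RHS]k1]; congr (k _); exact: val_inj.
Qed.

Lemma field_trace_quadratic (u v : rat) : field_trace (u%:A + v%:A * s) = u *+ 2.
Proof.
rewrite field_traceD mulr_algl !field_traceZ field_trace1 quadratic_dim.
rewrite (@field_trace_sqrt _ s m%:~R quadratic_dim) ?mulr0 ?addr0 ?mulr_natr//.
- by rewrite sm int_alg.
- exact: quadratic_irrational.
Qed.

(** A monic integral equation for [u + v s] is satisfied by both numbers
    [u + v y] and [u - v y] of [algC], where [y ^+ 2 = m]; so their sum [2 u]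
    and their product [u ^+ 2 - m v ^+ 2] are rational algebraic integers. *)
Lemma integral_quadraticP (u v : rat) :
  integralOver (intr : int -> K) (u%:A + v%:A * s) ->
  exists U V : int, [/\ u *+ 2 = U%:~R, v *+ 2 = V%:~R & (4 %| U ^+ 2 - m * V ^+ 2)%Z].
Proof.
move=> [p p_mon /rootP].
have [A [B E]] := horner_quadratic m%:~R u v (map_poly intr p).
have mapp (L : fieldType) (f : {rmorphism rat -> L}) :
    map_poly f (map_poly intr p) = map_poly intr p.
  by rewrite -map_poly_comp; apply: eq_map_poly => c /=; rewrite rmorph_int.
have := E K (in_alg K) s; rewrite mapp /= => -> ; last by rewrite sm -int_alg.
move=> /quadratic_coord_eq0[A0 B0].
have Ay (y : algC) : y ^+ 2 = m%:~R -> ratr u + ratr v * y \in Aint.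
  move=> ym; apply: (@root_monic_Aint (map_poly intr p)).
  - apply/rootP; have := E algC ratr y; rewrite mapp rmorph_int => /(_ ym) ->.
    by rewrite A0 B0 !rmorph0 mul0r addr0.
  - by rewrite monic_map.
  - by apply/polyOverP => i; rewrite coef_map rpred_int.
pose y : algC := sqrtC m%:~R; have ym : y ^+ 2 = m%:~R := sqrtCK _.
have Ap := Ay y ym; have An := Ay (- y) (etrans (sqrrN y) ym).
have /intrP[U UE] : u *+ 2 \is a Num.int.
  rewrite -Cint_rat; apply: Cint_rat_Aint; first exact: Crat_rat.
  suff -> : ratr (u *+ 2) = (ratr u + ratr v * y) + (ratr u + ratr v * - y) by exact: rpredD.
  by rewrite rmorphMn /=; ring.
have /intrP[w wE] : u ^+ 2 - m%:~R * v ^+ 2 \is a Num.int.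
  rewrite -Cint_rat; apply: Cint_rat_Aint; first exact: Crat_rat.
  suff -> : ratr (u ^+ 2 - m%:~R * v ^+ 2) =
      (ratr u + ratr v * y) * (ratr u + ratr v * - y) by exact: rpredM.
  by rewrite rmorphB rmorphM !rmorphXn rmorph_int /= -ym; ring.
have UVE : m%:~R * (v *+ 2) ^+ 2 = (U ^+ 2 - 4 * w)%:~R.
  by rewrite rmorphB rmorphXn rmorphM /= -UE -wE; ring.
have /intrP[V VE] : v *+ 2 \is a Num.int.
  by apply: (@sqfree_rat_int m) => //; rewrite UVE rpred_int.
exists U, V; split=> //; apply/dvdzP; exists w.
rewrite [RHS]mulrC; apply/eqP; rewrite subr_eq addrC -subr_eq; apply/eqP/(@intr_inj rat).
by rewrite -UVE VE rmorphM rmorphXn.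
Qed.

Definition quadratic_gen : K :=
  if (m == 1 %[mod 4])%Z then 2^-1%:A + 2^-1%:A * s else s.

Lemma integral_quadratic_gen : integralOver (intr : int -> K) quadratic_gen.
Proof.
rewrite /quadratic_gen; case: ifP => [m4|_].
  have [k kE] : {k | m = 1 + 4 * k} by exists (m %/ 4)%Z; lia.
  exists ('X^2 - ('X + k%:P)).
    by rewrite monicE lead_coefDl ?lead_coefXn// size_polyXn size_polyN size_XaddC.
  rewrite rmorphB rmorphD /= map_polyXn map_polyX map_polyC /=; apply/rootP.
  rewrite hornerD hornerN hornerXn hornerD hornerX hornerC /=.
  have two : 2 * 2^-1%:A = 1 :> K.
    by rewrite -[2^-1%:A]/(in_alg K 2^-1) -[2](rmorph_nat (in_alg K)) -rmorphM mulfV ?rmorph1.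
  have two0 : 2 != 0 :> K by apply/eqP => K2; move/eqP: two; rewrite K2 mul0r eq_sym oner_eq0.
  set h := 2^-1%:A in two *; apply: (mulfI two0); apply: (mulfI two0).
  have kK : s ^+ 2 = 1 + 4 * k%:~R by rewrite sm kE rmorphD rmorphM.
  transitivity ((2 * h) ^+ 2 * (1 + s) ^+ 2 - (2 * h) * 2 * (1 + s) - 4 * k%:~R); first by ring.
  rewrite two; transitivity (s ^+ 2 - 1 - 4 * k%:~R); first by ring.
  by rewrite kK; ring.
exists ('X^2 - m%:P); first exact: monicXnsubC.
rewrite rmorphB /= map_polyXn map_polyC; apply/rootP.
by rewrite hornerD hornerN hornerXn hornerC sm subrr.
Qed.

Lemma quadratic_integersP x : integralOver (intr : int -> K) x <->
  exists i j : int, x = i%:~R + j%:~R * quadratic_gen.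
Proof.
split=> [|[i [j ->]]]; last first.
  by apply: integral_add; [|apply: integral_mul integral_quadratic_gen]; exact: integral_id.
have [u [v ->]] := quadratic_coord x => /integral_quadraticP[U [V [UE VE dv]]].
have m4 : ~~ (4 %| m)%Z by exact: (sqm (p := 2)).
(* With [U = 2 i + a] and [V = 2 j + b], the last divisibility says that [4]
   divides [a - m b]; as [4] does not divide [m], either [a = b = 0], or
   [a = b = 1] and [m] is [1] modulo [4]. *)
have parity (W : int) : exists (k : int) (b : bool), W = k * 2 + b%:Z.
  by exists (W %/ 2)%Z, (W %% 2 == 1)%Z; lia.
have [[i [a iE]] [j [b jE]]] := (parity U, parity V).
have {}dv : (4 %| a%:Z - m * b%:Z)%Z.
  have /dvdzP[q qE] := dv; apply/dvdzP.
  exists (q - (i ^+ 2 + i * a%:Z - m * (j ^+ 2 + j * b%:Z))).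
  rewrite mulrBl -qE iE jE; case: (a); case: (b) => /=; ring.
have toK (w : rat) (W : int) : w *+ 2 = W%:~R -> 2 * w%:A = W%:~R :> K.
  by move=> wW; rewrite mulr_natl scalerMnl wW int_alg.
have two0 : 2 != 0 :> K by rewrite -(rmorph_nat (in_alg K)) fmorph_eq0.
have two : 2 * 2^-1%:A = 1 :> K by apply: (toK _ 1).
rewrite /quadratic_gen; case: ifP => m1'.
  exists (i - j), V; apply: (mulfI two0).
  transitivity (U%:~R + V%:~R * s : K); first by rewrite -(toK _ _ UE) -(toK _ _ VE); ring.
  have -> : U = (i - j) * 2 + V by move: dv; rewrite iE jE; case: (a); case: (b); lia.
  set h := 2^-1%:A in two *.
  transitivity (2 * (i - j)%:~R + V%:~R * ((2 * h) + (2 * h) * s) : K); last by ring.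
  by rewrite two rmorphD rmorphM; ring.
exists i, j; apply: (mulfI two0).
transitivity (U%:~R + V%:~R * s : K); first by rewrite -(toK _ _ UE) -(toK _ _ VE); ring.
have [-> ->] : U = i * 2 /\ V = j * 2 by move: dv; rewrite iE jE; case: (a); case: (b); lia.
by rewrite !rmorphM; ring.
Qed.

Lemma quadratic_gram_det (b : 'I_2 -> K) :
  b ord0 = 1 -> b (lift ord0 ord0) = quadratic_gen ->
  \det (\matrix_(i, j) field_trace (b i * b j)) = (quadratic_disc m)%:~R.
Proof.
move=> b0 b1.
have -> : \det (\matrix_(i, j) field_trace (b i * b j)) =
    field_trace (1 * 1 : K) * field_trace (quadratic_gen * quadratic_gen) -
    field_trace (1 * quadratic_gen) ^+ 2.
  rewrite (expand_det_row _ ord0) !big_ord_recl big_ord0 addr0.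
  rewrite /cofactor !det_mx11 !mxE /= !(b0, b1) -?[lift (lift _ _) _]/ord0.
  have -> : lift (lift ord0 ord0) ord0 = ord0 :> 'I_2 by exact: val_inj.
  by rewrite !(b0, b1) !mul1r /bump /= addn1 expr1 mulN1r mulr1 mulrN expr2.
have tr1 : field_trace (1 * 1 : K) = 2.
  by have := field_trace_quadratic 1 0; rewrite scale1r scale0r mul0r addr0 mulr1.
have two : 2 * 2^-1%:A = 1 :> K.
  by rewrite mulr_natl scalerMnl -mulr_natl mulfV// scale1r.
have two0 : 2 != 0 :> K by rewrite -(rmorph_nat (in_alg K)) fmorph_eq0.
rewrite tr1 mul1r /quadratic_gen /quadratic_disc; case: ifP => _.
  have -> : (2^-1%:A + 2^-1%:A * s) * (2^-1%:A + 2^-1%:A * s) =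
      ((1 + m%:~R) / 4)%:A + 2^-1%:A * s :> K.
    have -> : ((1 + m%:~R) / 4)%:A = 2^-1%:A * 2^-1%:A * (1 + s ^+ 2) :> K.
      rewrite sm int_alg -[(_ / _)%:A]/(in_alg K _) -[2^-1%:A]/(in_alg K _).
      rewrite -[X in _ * (_ + X)]/(in_alg K _) -(rmorph1 (in_alg K)) -rmorphD -!rmorphM.
      by congr (in_alg K _); field.
    apply: (mulfI two0); set h := 2^-1%:A in two *.
    transitivity ((2 * h) * (h + 2 * h * s + h * s ^+ 2)); first by ring.
    transitivity ((2 * h) * (h * (1 + s ^+ 2)) + (2 * h) * s); last by ring.
    by rewrite !two; ring.
  by rewrite !field_trace_quadratic; field.
have -> : s * s = (m%:~R)%:A + 0%:A * s by rewrite -expr2 sm int_alg scale0r mul0r addr0.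
have -> : field_trace s = 0.
  by have := field_trace_quadratic 0 1; rewrite scale0r scale1r add0r mul1r mul0rn.
by rewrite field_trace_quadratic rmorphM /=; ring.
Qed.

(** The given integral basis and the basis [1, quadratic_gen] are expressed
    through each other by integral matrices, so the two Gram determinants
    differ by factors that are squares of integers, in both directions. *)
Lemma is_discriminant_quadratic (D : int) :
  is_discriminant K D -> D = quadratic_disc m.
Proof.
move=> [b [_ bint] DE]; move: b bint DE; rewrite quadratic_dim => b bint DE.
pose b' (i : 'I_2) : K := if i == ord0 then 1 else quadratic_gen.
have gram : \det (\matrix_(i, j) field_trace (b' i * b' j)) = (quadratic_disc m)%:~R.
  exact: quadratic_gram_det.
have change (x y : 'I_2 -> K) : (forall i, exists c : 'I_2 -> int, x i = \sum_j y j *~ c j) ->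
    exists d : int, \det (\matrix_(i, j) field_trace (x i * x j)) =
      d%:~R ^+ 2 * \det (\matrix_(i, j) field_trace (y i * y j)).
  move=> /choice[c xE]; pose M := \matrix_(i, j) c i j; exists (\det M).
  rewrite -det_map_mx; set M' := map_mx _ M; set G := \matrix_(i, j) field_trace (y i * y j).
  transitivity (\det (M' *m G *m M'^T)); last by rewrite !det_mulmx det_tr; ring.
  congr (\det _); apply/matrixP => i j; rewrite !mxE !xE !big_ord_recl !big_ord0 !addr0.
  rewrite !mxE !big_ord_recl !big_ord0 !addr0 !mxE.
  rewrite -!(mulrzr (y _)) !int_alg !mulr_algr.
  rewrite mulrDl !mulrDr -!scalerAl -!scalerAr !field_traceD !field_traceZ.
  by ring.
have intb i : integralOver (intr : int -> K) (tnth b i).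
  apply/bint; exists (fun j => (i == j)%:Z).
  rewrite (bigD1 i)//= eqxx big1 ?addr0// => j ji.
  by rewrite eq_sym (negbTE ji) mulr0z.
have intb' i : integralOver (intr : int -> K) (b' i).
  by rewrite /b'; case: ifP => _; [exact: integral1|exact: integral_quadratic_gen].
have [d1 E1] : exists d : int, \det (\matrix_(i, j) field_trace (b' i * b' j)) =
      d%:~R ^+ 2 * \det (\matrix_(i, j) field_trace (tnth b i * tnth b j)).
  by apply: change => i; apply/bint.
have [d2 E2] : exists d : int, \det (\matrix_(i, j) field_trace (tnth b i * tnth b j)) =
      d%:~R ^+ 2 * \det (\matrix_(i, j) field_trace (b' i * b' j)).
  apply: change => i; have /quadratic_integersP[u [v ->]] := intb i.
  exists (fun j => if j == ord0 then u else v).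
  by rewrite !big_ord_recl big_ord0 addr0 /b' /= mulrzl.
rewrite gram -DE in E1 E2.
have {}E1 : quadratic_disc m = d1 ^+ 2 * D.
  by apply: (@intr_inj rat); rewrite E1 rmorphM rmorphXn.
have {}E2 : D = d2 ^+ 2 * quadratic_disc m.
  by apply: (@intr_inj rat); rewrite E2 rmorphM rmorphXn.
have q0 : quadratic_disc m != 0 by rewrite /quadratic_disc; case: ifP => _; rewrite ?mulf_neq0.
have : (d1 * d2) ^+ 2 = 1.
  apply: (mulIf q0); rewrite mul1r.
  by transitivity (d1 ^+ 2 * (d2 ^+ 2 * quadratic_disc m)); [ring|rewrite -E2 -E1].
move=> /eqP; rewrite sqrf_eq1 => dd.
have : absz (d1 * d2)%R = 1%N by case/orP: dd => /eqP ->.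
rewrite abszM => /eqP; rewrite muln_eq1 => /andP[/eqP d11 _].
have [d1E|d1E] : d1 = 1 \/ d1 = -1 by lia.
  by rewrite E1 d1E expr1n mul1r.
by rewrite E1 d1E sqrrN expr1n mul1r.
Qed.

End QuadraticField.

(** * Automorphisms of the group of radicals *)

Lemma size_fset_set_image (T U : choiceType) (f : T -> U) (s : seq T) :
  uniq s -> {in s &, injective f} ->
  size (finmap.enum_fset (fset_set [set f x | x in [set` s]])) = size s.
Proof.
move=> us finj; pose S := finmap.seq_fset tt s.
have -> : [set` s] = [set` S].
  by apply/seteqP; split => x /=; rewrite finmap.seq_fsetE.
have fS : finite_set [set` S] by exact: finite_fset.
rewrite fset_set_image// set_fsetK finmap.card_in_imfset /=.
  by rewrite (finmap.size_seq_fset tt) undup_id.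
by move=> x y /=; rewrite !finmap.seq_fsetE; exact: finj.
Qed.

(** The only rational numbers of modulus [1] are [1] and [-1]. *)
Lemma rat_unity_root n (x : algC) : x \in Crat -> (0 < n)%N -> x ^+ n = 1 ->
  x = 1 \/ (x = -1 /\ ~~ odd n).
Proof.
move=> xQ n0 xn; have xR := Creal_Crat xQ.
have x1 : `|x| = 1.
  by apply/eqP; rewrite -(@pexpr_eq1 _ _ n)// -normrX xn normr1.
case: (real_ge0P xR) x1 => [_|_ xE]; first by left.
have {}xE : x = -1 by rewrite -xE opprK.
right; split=> //; apply/negP => on; move: xn; rewrite xE -signr_odd on expr1 => /eqP.
by rewrite eq_sym -subr_eq0 opprK -(natrD _ 1 1) pnatr_eq0.
Qed.

Lemma exprzX (x : algC) (c : int) (m : nat) : (x ^ c) ^+ m = (x ^+ m) ^ c.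
Proof. by rewrite !exprnP exprzAC. Qed.

Section RadicalAut.
Variables (a : int) (n d : nat).
Hypothesis a2 : (1 < `|a|)%N.
Hypothesis n0 : (0 < n)%N.
Hypothesis d0 : (0 < d)%N.
Hypothesis dP : forall k : nat,
  (exists2 b : algC, b \in Crat & b ^+ n = a%:~R ^+ k) <-> (d %| k)%N.

Let a0 : a%:~R != 0 :> algC.
Proof. by rewrite intr_eq0 -absz_gt0 (ltn_trans _ a2). Qed.

Let expz_inj (k l : int) : a%:~R ^ k = a%:~R ^ l :> algC -> k = l.
Proof.
have key (m : nat) : a%:~R ^+ m = 1 :> algC -> m = 0%N.
  rewrite -rmorphXn -[1](rmorph1 intr) => /intr_inj/(congr1 absz).
  rewrite abszX => /eqP; rewrite -[absz 1]/(`|a| ^ 0)%N eqn_exp2l//.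
  by move/eqP.
move=> E; apply/eqP; rewrite -subr_eq0; move: E.
have kl : k = (k - l) + l by rewrite subrK.
rewrite {1}kl expfzDr// -[RHS]mul1r => /(mulIf (expfz_neq0 _ a0)).
case: (k - l) => m; first by rewrite -exprnP => /key ->.
by rewrite NegzE -exprnN => /eqP; rewrite invr_eq1 => /eqP/key.
Qed.

Lemma rational_radical_exponent (b : algC) (k : int) :
  b \in Crat -> b ^+ n = a%:~R ^ k -> (d %| k)%Z.
Proof.
case: k => k bQ bk; first by apply/dP; exists b.
rewrite NegzE dvdzE abszN; apply/dP; exists b^-1; first by rewrite rpredV.
by rewrite exprVn bk NegzE -exprnN invrK.
Qed.

Let d_dvd_n : (d %| n)%N.
Proof. by apply/dP; exists a%:~R => //; apply: rpred_int. Qed.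

Local Notation t := (n %/ d)%N.
Let dt : n = (d * t)%N.
Proof. by rewrite mulnC divnK. Qed.
Let t0 : (0 < t)%N.
Proof. by rewrite divn_gt0// dvdn_leq. Qed.

Variable z : algC.
Hypothesis pz : n.-primitive_root z.
Let zn : z ^+ n = 1 := prim_expr_order pz.

Let z_neq0 : z != 0.
Proof. exact: (root_neq0 n0 zn (oner_neq0 _)). Qed.

Let al : algC := n.-root a%:~R.
Let aln : al ^+ n = a%:~R.
Proof. exact: rootCK. Qed.
Let al0 : al != 0.
Proof. exact: (root_neq0 n0 aln a0). Qed.

Let alX (k : int) : (al ^ k) ^+ n = a%:~R ^ k.
Proof. by rewrite exprnP exprzAC -exprnP aln. Qed.

(** On the radicals this is a homomorphism to the integers; outside it takes
    the default value [0]. *)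
Let kexp (x : algC) : int := xget 0 [set k | x ^+ n = a%:~R ^ k].

Let kexpE x k : x ^+ n = a%:~R ^ k -> kexp x = k.
Proof. by move=> xk; apply: xget_unique => // l /=; rewrite xk => /expz_inj. Qed.

Lemma radicalsP x : radicals a n x -> exists (k : int) (j : nat),
  x = z ^+ j * al ^ k /\ x ^+ n = a%:~R ^ k.
Proof.
move=> [x0 [k xk]]; have : (x / al ^ k) ^+ n = 1.
  by rewrite expr_div_n xk alX divff// expfz_neq0.
move/(prim_rootP pz) => [j jE]; exists k, j; split=> //.
by rewrite -jE divfK// expfz_neq0.
Qed.

Section Parametrization.
Variables (be : algC) (j0 : nat).
Hypothesis beQ : be \in Crat.
Hypothesis beE : be = z ^+ j0 * al ^+ d.

Let be0 : be != 0.
Proof. by rewrite beE mulf_neq0// expf_neq0// z_neq0. Qed.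

Let z0 j : z ^+ j != 0.
Proof. by rewrite expf_neq0// z_neq0. Qed.

Let zjn j : (z ^+ j) ^+ n = 1.
Proof. by rewrite exprAC zn expr1n. Qed.

Let ben : be ^+ n = a%:~R ^+ d.
Proof. by rewrite beE exprMn zjn mul1r exprAC aln. Qed.

(** The endomorphism of the group of radicals that maps [z] to [z ^+ u] and
    [al] to [y]. *)
Definition radical_map (u : nat) (y x : algC) : algC :=
  (x / al ^ kexp x) ^+ u * y ^ kexp x.

Let kexp_mul y j k : y ^+ n = a%:~R -> kexp (z ^+ j * y ^ k) = k.
Proof.
by move=> yn; apply: kexpE; rewrite exprMn zjn mul1r exprnP exprzAC -exprnP yn.
Qed.

Lemma radical_mapE u y j k : radical_map u y (z ^+ j * al ^ k) = z ^+ (j * u) * y ^ k.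
Proof. by rewrite /radical_map (kexp_mul _ _ aln) mulfK ?expfz_neq0// exprM. Qed.

Lemma radicals_mul y j k : y ^+ n = a%:~R -> radicals a n (z ^+ j * y ^ k).
Proof.
move=> yn; split; last by exists k; rewrite exprMn zjn mul1r exprnP exprzAC -exprnP yn.
by rewrite mulf_neq0// expfz_neq0// (root_neq0 n0 yn a0).
Qed.

Definition radical_of (x : algC) : radical_group a n :=
  if pselect (radicals a n x) is left xR then radical_mk xR else radical_one a n.

Lemma radical_ofK x : radicals a n x -> val (radical_of x) = x.
Proof. by move=> xR; rewrite /radical_of; case: pselect. Qed.

Lemma val_radical_of (x : radical_group a n) : radical_of (val x) = x.
Proof. by apply: val_inj; rewrite radical_ofK//; exact: set_valP. Qed.

Definition radical_fun u y (x : radical_group a n) : radical_group a n :=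
  radical_of (radical_map u y (val x)).

Lemma radical_funE u y j k : y ^+ n = a%:~R ->
  radical_fun u y (radical_of (z ^+ j * al ^ k)) = radical_of (z ^+ (j * u) * y ^ k).
Proof.
by move=> yn; rewrite /radical_fun radical_ofK ?radical_mapE//; exact: radicals_mul.
Qed.

Lemma radical_groupP y (x : radical_group a n) : y ^+ n = a%:~R ->
  exists (k : int) (j : nat), x = radical_of (z ^+ j * y ^ k).
Proof.
move=> yn; have y0 := root_neq0 n0 yn a0.
have [k [j [xE xn]]] := radicalsP (set_valP x).
have : (val x / y ^ k) ^+ n = 1.
  rewrite expr_div_n xn exprnP exprzAC -exprnP yn divff// expfz_neq0//.
move/(prim_rootP pz) => [i iE]; exists k, i; rewrite -iE divfK ?expfz_neq0//.
by rewrite val_radical_of.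
Qed.

Lemma radical_ofM y j k j' k' : y ^+ n = a%:~R ->
  (radical_of (z ^+ j * y ^ k)%R * radical_of (z ^+ j' * y ^ k')%R)%g =
  radical_of (z ^+ (j + j') * y ^ (k + k')).
Proof.
move=> yn; have R i l := radical_ofK (radicals_mul i l yn).
apply: val_inj; rewrite (R (j + j')%N).
rewrite -[LHS]/(val (radical_of _) * val (radical_of _)) (R j) (R j').
have y0 := root_neq0 n0 yn a0.
rewrite (exprD z j j').
rewrite (expfzDr k k' y0).
exact: mulrACA.
Qed.

(** The rational radicals are the powers of [be], up to sign: such a radical
    [x] has exponent [c * d], and [x / be ^ c] is a rational root of unity.  It
    can be [-1] only for even [n], and then [u] is odd.  So it suffices that
    [be] be fixed. *)
Lemma radical_fun_aut u y : coprime u n -> y ^+ n = a%:~R ->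
  z ^+ (j0 * u) * y ^+ d = be -> radical_aut (radical_fun u y).
Proof.
move=> cu yn yd; split.
- move=> x x'; have [k [j ->]] := radical_groupP x aln.
  have [k' [j' ->]] := radical_groupP x' aln.
  by rewrite radical_ofM// !radical_funE// radical_ofM// mulnDl.
- pose u' := (u ^ (totient n).-1)%N.
  have uu' i : z ^+ (i * u * u') = z ^+ i.
    apply/eqP; rewrite -mulnA -expnS prednK ?totient_gt0// (eq_prim_root_expr pz).
    by rewrite -modnMmr cyclic.Euler_exp_totient// modnMmr muln1.
  pose g (x : radical_group a n) :=
    radical_of ((val x / y ^ kexp (val x)) ^+ u' * al ^ kexp (val x)).
  have y0 := root_neq0 n0 yn a0.
  have gE j k : g (radical_of (z ^+ j * y ^ k)) = radical_of (z ^+ (j * u') * al ^ k).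
    rewrite /g radical_ofK; last exact: radicals_mul.
    by rewrite (kexp_mul _ _ yn) mulfK ?expfz_neq0// -exprM.
  exists g => x; last have [k [j ->]] := radical_groupP x yn.
    have [k [j ->]] := radical_groupP x aln.
    by rewrite radical_funE// gE uu'.
  by rewrite gE radical_funE// mulnAC uu'.
- move=> x; rewrite /set_val /= => xQ; have [k [j xE]] := radical_groupP x aln.
  have vx : val x = z ^+ j * al ^ k by rewrite xE radical_ofK//; exact: radicals_mul.
  have xn : val x ^+ n = a%:~R ^ k by rewrite vx exprMn zjn mul1r alX.
  have /dvdzP[c cE] := rational_radical_exponent xQ xn.
  pose ep := val x / be ^ c.
  have epQ : ep \in Crat by rewrite rpred_div// rpredXz.
  have epn : ep ^+ n = 1.
    have aE : a%:~R ^ k = (a%:~R ^+ d) ^ c :> algC.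
      by rewrite exprnP exprz_exp cE mulrC.
    rewrite expr_div_n xn exprzX ben aE divff//.
    by rewrite expfz_neq0// expf_neq0.
  have epu : ep ^+ u = ep.
    case: (rat_unity_root epQ n0 epn) => [->|[-> en]]; first by rewrite expr1n.
    have ou : odd u.
      by rewrite -coprimen2; apply: coprime_dvdr cu; rewrite dvdn2.
    by rewrite -signr_odd ou.
  have yk (y' : algC) : y' ^ k = (y' ^+ d) ^ c.
    by rewrite exprnP exprz_exp cE mulrC.
  have zj : z ^+ j = ep * (z ^+ j0) ^ c.
    apply: (mulIf (expfz_neq0 k al0)); rewrite -vx -mulrA yk -expfzMl -beE.
    by rewrite /ep divfK// expfz_neq0.
  rewrite xE radical_funE//; congr radical_of; rewrite -vx exprM zj exprMn epu.
  rewrite exprzX -exprM yk -mulrA -expfzMl yd.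
  by rewrite /ep divfK// expfz_neq0.
Qed.

(** Conversely, injectivity forces an automorphism to raise [z] to a power
    prime to [n], and the image of [al] satisfies the equation that [be] be
    fixed. *)
Lemma radical_aut_fun f : radical_aut f -> exists u y,
  [/\ (u < n)%N, coprime u n, y ^+ n = a%:~R,
      z ^+ (j0 * u) * y ^+ d = be & f = radical_fun u y].
Proof.
move=> [fM fB fQ]; pose g (x : algC) := val (f (radical_of x)).
have R j (k : int) : radicals a n (z ^+ j * al ^ k) := radicals_mul j k aln.
have Rz j : radicals a n (z ^+ j) by have := R j 0; rewrite expr0z mulr1.
have Ra (k : int) : radicals a n (al ^ k) by have := R 0%N k; rewrite mul1r.
have gM x x' : radicals a n x -> radicals a n x' -> g (x * x') = g x * g x'.
  move=> rx rx'; rewrite /g -[RHS]/(val (f (radical_of x) * f (radical_of x'))%g) -fM.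
  congr (val (f _)); apply: val_inj; rewrite (radical_ofK (radicalsM rx rx')).
  by rewrite -[RHS]/(val (radical_of x) * val (radical_of x')) (radical_ofK rx) (radical_ofK rx').
have gQ x : radicals a n x -> x \in Crat -> g x = x.
  move=> rx xQ; rewrite /g fQ ?(radical_ofK rx)//.
  by rewrite -[set_val _]/(val _) (radical_ofK rx).
have R1 : radicals a n 1 := radicals1 a n.
have g1 : g 1 = 1 by apply: gQ => //; exact: rpred1.
have gX x j : radicals a n x -> g (x ^+ j) = g x ^+ j.
  move=> rx; suff [] : radicals a n (x ^+ j) /\ g (x ^+ j) = g x ^+ j by [].
  elim: j => [|j [rj IH]]; first by rewrite !expr0.
  by rewrite !exprS (gM _ _ rx rj) IH; split=> //; exact: radicalsM.
have gV x : radicals a n x -> g x^-1 = (g x)^-1.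
  move=> rx; have := gM _ _ (radicalsV rx) rx.
  have [x0 _] := rx; rewrite (mulVf x0) g1 => gg.
  have gx0 : g x != 0 by apply/eqP => gx0; move/eqP: gg; rewrite gx0 mulr0 oner_eq0.
  by apply: (mulIf gx0); rewrite -gg mulVf.
have gz (x : algC) (k : int) : radicals a n x -> g (x ^ k) = g x ^ k.
  move=> rx; case: k => k; first exact: gX.
  rewrite NegzE -!exprnN -gX// gV//.
  by elim: k.+1 => [|j rj]; rewrite ?expr0// exprS; exact: radicalsM.
pose y := g al; have Ral : radicals a n al by have := Ra 1; rewrite expr1z.
have Rz1 : radicals a n z by have := Rz 1%N; rewrite expr1.
have yn : y ^+ n = a%:~R.
  rewrite -gX// aln gQ ?rpred_int// -aln.
  by have := Ra n%:Z.
have : g z ^+ n = 1 by rewrite -gX// zn.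
move/(prim_rootP pz) => [u uE].
have cu : coprime u n.
  rewrite coprime_sym; apply: contrapT => /negP; rewrite /coprime => g1n.
  (* Otherwise a proper power of [z] would be mapped to [1]. *)
  set q := gcdn n u in g1n.
  have q0 : (0 < q)%N by rewrite gcdn_gt0 n0.
  have gq : g (z ^+ (n %/ q)) = g 1.
    rewrite gX// uE -exprM g1; apply/eqP; rewrite -(prim_order_dvd pz).
    by rewrite -{1}(divnK (dvdn_gcdl n u)) mulnC dvdn_mul// dvdn_gcdr.
  have : z ^+ (n %/ q) = 1.
    have [f' fK _] := fB.
    rewrite -(radical_ofK (Rz _)) -[RHS](radical_ofK R1); congr (val _).
    by apply: (can_inj fK); apply: val_inj; exact: gq.
  move/eqP; rewrite -(prim_order_dvd pz) => /dvdn_leq.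
  rewrite divn_gt0// dvdn_leq ?dvdn_gcdl// => /(_ isT).
  by rewrite leqNgt ltn_Pdiv// ltn_neqAle eq_sym g1n.
exists u, y; split=> //.
  have Rbe : radicals a n be by rewrite beE; exact: (R j0 d%:Z).
  rewrite -[RHS](gQ be)// beE (gM _ _ (Rz _) (Ra d%:Z)) gX// gz// uE.
  by rewrite -exprM mulnC.
apply/funext => x; have [k [j ->]] := radical_groupP x aln.
rewrite radical_funE//; apply: val_inj; rewrite (radical_ofK (radicals_mul _ _ yn)).
by rewrite -[LHS]/(g _) (gM _ _ (Rz _) (Ra _)) gX// gz// uE -exprM mulnC.
Qed.

End Parametrization.

(** For each [u] prime to [n] the admissible images [y] of [al] are the
    solutions of [y ^+ d = be / z ^+ (j0 * u)]; they form one class modulo the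
    [d]-th roots of unity, and all of them satisfy [y ^+ n = a]. *)
Lemma cardA_totient : cardA a n = (totient n * d)%N.
Proof.
have [be0 beQ ben] : exists2 b : algC, b \in Crat & b ^+ n = a%:~R ^+ d.
  exact/dP.
have [j0 be0E] : exists j0 : nat, be0 = z ^+ j0 * al ^+ d.
  have rbe : radicals a n be0.
    split; last by exists d%:Z.
    exact: (root_neq0 n0 ben (expf_neq0 d a0)).
  have [k [j [bE bk]]] := radicalsP rbe; exists j; rewrite bE; congr (_ * _).
  by rewrite exprnP; congr (_ ^ _); apply: expz_inj; rewrite -bk ben.
pose y0 u := d.-root (be0 / z ^+ (j0 * u)).
have y0d u : y0 u ^+ d = be0 / z ^+ (j0 * u) by exact: rootCK.
have zj (j : nat) : z ^+ j != 0 by exact: expf_neq0.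
(* [be ^+ t / a] is a rational root of unity, hence equal to its [u]-th power. *)
have y0n u : coprime u n -> y0 u ^+ n = a%:~R.
  move=> cu; pose ep := z ^+ (j0 * t).
  have epE : be0 ^+ t = ep * a%:~R.
    by rewrite be0E exprMn -!exprM -dt aln.
  have epQ : ep \in Crat.
    have -> : ep = be0 ^+ t / a%:~R by rewrite epE mulfK.
    by rewrite rpred_div ?rpredX// rpred_int.
  have epn : ep ^+ n = 1 by rewrite exprAC zn expr1n.
  have epu : ep ^+ u = ep.
    case: (rat_unity_root epQ n0 epn) => [->|[-> en]]; first by rewrite expr1n.
    have ou : odd u.
      by rewrite -coprimen2; apply: coprime_dvdr cu; rewrite dvdn2.
    by rewrite -signr_odd ou.
  have -> : y0 u ^+ n = (y0 u ^+ d) ^+ t by rewrite -exprM -dt.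
  rewrite y0d expr_div_n epE -exprM -mulnA [(u * t)%N]mulnC mulnA exprM -/ep epu.
  by rewrite [ep * _]mulrC mulfK /ep.
pose yy (p : nat * nat) := y0 p.1 * z ^+ (t * p.2).
have ztd w : (z ^+ (t * w)) ^+ d = 1.
  by rewrite -exprM mulnAC [(t * d)%N]mulnC -dt exprM zn expr1n.
have yyd p : yy p ^+ d = be0 / z ^+ (j0 * p.1) by rewrite exprMn ztd mulr1 y0d.
have yyn p : coprime p.1 n -> yy p ^+ n = a%:~R.
  by move=> cp; rewrite exprMn y0n// -[z ^+ _ ^+ n]exprAC zn expr1n mulr1.
pose s := [seq (u, w) | u <- [seq u <- iota 0 n | coprime u n], w <- iota 0 d].
have sP p : p \in s -> [/\ (p.1 < n)%N, coprime p.1 n & (p.2 < d)%N].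
  move=> /allpairsP[[u w] /= [+ + ->]] /=.
  by rewrite mem_filter !mem_iota /= add0n => /andP[-> ->].
have -> : (totient n * d)%N = size s.
  rewrite size_allpairs size_iota size_filter; congr (_ * _)%N.
  rewrite totient_count_coprime -sum1_count [RHS]big_mkcond /= /index_iota subn0.
  by apply: eq_bigr => u _; rewrite coprime_sym; case: coprime.
rewrite /cardA.
have -> : radical_aut (a := a) (n := n) =
    [set radical_fun p.1 (yy p) | p in [set` s]].
  apply/seteqP; split=> [f /(radical_aut_fun beQ be0E)[u [y [un cu yn yd ->]]]|f /=].
    have /(prim_rootP (dvdn_prim_root pz d_dvd_n)) : (y / y0 u) ^+ d = 1.
      rewrite expr_div_n y0d -yd [_ * y ^+ d]mulrC mulfK// divff//.
      exact/expf_neq0/(root_neq0 n0 yn a0).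
    move=> [w wE]; exists (u, nat_of_ord w) => /=.
      by apply/allpairsP; exists (u, nat_of_ord w); rewrite /= mem_filter cu !mem_iota /= add0n un ltn_ord.
    congr (radical_fun _ _); rewrite /yy /= exprM -wE mulrC divfK//.
    exact: (root_neq0 n0 (y0n u cu) a0).
  move=> [p /sP[pn cp pd] <-]; apply: (radical_fun_aut beQ be0E cp (yyn p cp)).
  by rewrite yyd mulrC divfK.
rewrite size_fset_set_image//.
  apply: allpairs_uniq; [exact/filter_uniq/iota_uniq|exact: iota_uniq|].
  by move=> [? ?] [? ?].
move=> p q /sP[pn cp pd] /sP[qn cq qd] pq.
have z_eq (i j : nat) : (i < n)%N -> (j < n)%N -> z ^+ i = z ^+ j -> i = j.
  by move=> ni nj /eqP; rewrite (eq_prim_root_expr pz) !modn_small// => /eqP.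
have pq1 : p.1 = q.1.
  apply: z_eq => //; have /(congr1 (fun f => val (f (radical_of (z ^+ 1 * al ^ 0))))) := pq.
  rewrite (radical_funE _ _ _ (yyn p cp)) (radical_funE _ _ _ (yyn q cq)).
  rewrite (radical_ofK (radicals_mul _ _ (yyn p cp))) (radical_ofK (radicals_mul _ _ (yyn q cq))).
  by rewrite !expr0z !mulr1 !mul1n.
have pq2 : (t * p.2)%N = (t * q.2)%N.
  have tlt w : (w < d)%N -> (t * w < n)%N.
    by move=> wd; rewrite [X in (_ < X)%N]dt [X in (_ < X)%N]mulnC ltn_pmul2l.
  apply: z_eq; [exact: tlt|exact: tlt|].
  have /(congr1 (fun f => val (f (radical_of (z ^+ 0 * al ^ 1))))) := pq.
  rewrite (radical_funE _ _ _ (yyn p cp)) (radical_funE _ _ _ (yyn q cq)).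
  rewrite (radical_ofK (radicals_mul _ _ (yyn p cp))) (radical_ofK (radicals_mul _ _ (yyn q cq))).
  rewrite !expr1z !mul0n !mul1r /yy pq1; apply: mulfI.
  exact: (root_neq0 n0 (y0n _ cq) a0).
have /eqP := pq2; rewrite eqn_pmul2l// => /eqP.
by move: pq1; case: (p) => ? ?; case: (q) => ? ? /= -> ->.
Qed.

End RadicalAut.

(** * The degree of the splitting field *)

(** By the primitive element theorem [L] is generated by a root of a rational
    polynomial, which is sent to a root of the same polynomial in [algC]. *)
Lemma num_field_embeds (L : fieldExtType rat) : exists QsC : {rmorphism L -> algC}, True.
Proof.
have L0 : has_pchar0 L by move=> p; rewrite pchar_lalg pchar_num.
have [th thE] : exists th : L, <<1; th>>%VS = {:L}%VS.
  exists (separable_generator 1 {:L}); apply/esym/eq_adjoin_separable_generator.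
    by apply/separableP => y _; apply: pcharf0_separable.
  exact: subvf.
have /polyOver1P[m mE] := minPolyOver 1 th.
have m_th : root (map_poly (in_alg L) m) th by rewrite -mE root_minPoly.
have m_dvd (q : {poly rat}) : root (map_poly (in_alg L) q) th -> m %| q.
  move=> qth; rewrite -(dvdp_map (in_alg L)) -mE; apply: minPoly_dvdp => //.
  by apply/polyOver1P; exists q.
have [t mt] : exists t, root (pQtoC m) t.
  apply/closed_rootP; rewrite size_map_poly -(size_map_poly (in_alg L)) -mE.
  by rewrite size_minPoly eqSS -lt0n.
have qP (x : L) : exists q : {poly rat}, x == (map_poly (in_alg L) q).[th].
  have : x \in <<1; th>>%VS by rewrite thE memvf.
  by move=> /Fadjoin_polyP[q /polyOver1P[q' ->] ->]; exists q'.
pose q x := xchoose (qP x); pose f x := (pQtoC (q x)).[t].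
have fE x (p : {poly rat}) : x = (map_poly (in_alg L) p).[th] -> f x = (pQtoC p).[t].
  move=> xE; apply/eqP; rewrite -subr_eq0 /f -hornerN -hornerD -rmorphB.
  have /m_dvd/dvdpP[c ->] : root (map_poly (in_alg L) (q x - p)) th.
    by rewrite /root rmorphB hornerD hornerN -xE subr_eq0 eq_sym (xchooseP (qP x)).
  by rewrite rmorphM hornerM (rootP mt) mulr0.
have qE x : x = (map_poly (in_alg L) (q x)).[th] by apply/eqP/(xchooseP (qP x)).
have fB : zmod_morphism f.
  move=> x y; rewrite (fE _ (q x - q y)); first by rewrite rmorphB hornerD hornerN.
  by rewrite rmorphB hornerD hornerN -!qE.
have fM : monoid_morphism f.
  split=> [|x y].
    by rewrite (fE _ 1) ?rmorph1 ?hornerC.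
  rewrite (fE _ (q x * q y)); first by rewrite rmorphM hornerM.
  by rewrite rmorphM hornerM -!qE.
pose fBM := GRing.isZmodMorphism.Build _ _ f fB.
pose fMM := GRing.isMonoidMorphism.Build _ _ f fM.
pose fRM : {rmorphism L -> algC} := HB.pack f fBM fMM.
by exists fRM.
Qed.

Section RadicalExtension.
Variables (a : int) (n d : nat).
Hypothesis a0 : a != 0.
Hypothesis n0 : (0 < n)%N.
Hypothesis d0 : (0 < d)%N.
Variable z : algC.
Hypothesis pz : n.-primitive_root z.
Hypothesis dP : forall k : nat,
  (exists2 b : algC, in_adjoin z b & b ^+ n = a%:~R ^+ k) <-> (d %| k)%N.

(** The field is generated by [z], of degree [totient n], and by [al].  The
    minimal polynomial of [al] over [Q(z)] divides ['X^d - al ^+ d]; it also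
    divides ['X^n - a], so its constant coefficient is, up to sign and a root
    of unity, the power of [al] whose exponent is its degree.  As this
    coefficient lies in [Q(z)], the degree is a multiple of [d]. *)
Lemma cardG_totient : cardG a n = (totient n * d)%N.
Proof.
rewrite /cardG /splitting_Xn_sub; case: splitting_num_field => L /=.
set p := 'X^n - _ => splL.
have pE (F : fieldType) (f : {rmorphism rat -> F}) : map_poly f p = 'X^n - (a%:~R)%:P.
  by rewrite rmorphB /= map_polyXn map_polyC /= rmorph_int.
have p0 : p != 0 by rewrite monic_neq0// monicXnsubC.
have [rs prs genL] := splL p0; rewrite {}pE in prs.
have [f _] := num_field_embeds L.
have fQ (q : {poly rat}) : map_poly f (map_poly (in_alg L) q) = pQtoC q.
  rewrite -map_poly_comp; apply: eq_map_poly => c /=.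
  by rewrite alg_num_field; exact: fmorph_rat.
have a0C : a%:~R != 0 :> algC by rewrite intr_eq0.
have prodL : 'X^n - (a%:~R)%:P = \prod_(r <- rs) ('X - r%:P) :> {poly L}.
  apply/eqP; rewrite -eqp_monic ?monicXnsubC// monic_prod// => r _.
  exact: monicXsubC.
have prodC : 'X^n - (a%:~R)%:P = \prod_(r <- rs) ('X - (f r)%:P) :> {poly algC}.
  have := congr1 (map_poly f) prodL; rewrite rmorphB /= map_polyXn map_polyC /= rmorph_int.
  by move=> ->; rewrite rmorph_prod /=; apply: eq_bigr => r _; rewrite map_polyXsubC.
have in_rs (x : algC) : x ^+ n = a%:~R -> exists2 r, r \in rs & f r = x.
  move=> xn; have : root ('X^n - (a%:~R)%:P) x by rewrite /root !hornerE xn subrr.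
  rewrite prodC -(big_map f xpredT (fun r => 'X - r%:P)) root_prod_XsubC.
  by move=> /mapP[r ? ->]; exists r.
have rsn r : r \in rs -> f r ^+ n = a%:~R.
  move=> rrs; have : root ('X^n - (a%:~R)%:P) (f r).
    by rewrite prodC -(big_map f xpredT (fun r => 'X - r%:P)) root_prod_XsubC map_f.
  by rewrite /root !hornerE subr_eq0 => /eqP.
have zn := prim_expr_order pz.
have [al alrs falE] := in_rs _ (rootCK n0 a%:~R).
have aln : f al ^+ n = a%:~R by rewrite falE rootCK.
have fal0 := root_neq0 n0 aln a0C.
have [r1 _ fr1] : exists2 r, r \in rs & f r = z * f al.
  by apply: in_rs; rewrite exprMn zn mul1r.
pose ze := r1 / al; have fze : f ze = z by rewrite fmorph_div fr1 mulfK.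
have rsE r : r \in rs -> exists i : nat, r = ze ^+ i * al.
  move=> /rsn rn; have /(prim_rootP pz)[i iE] : (f r / f al) ^+ n = 1.
    by rewrite expr_div_n rn aln divff.
  exists i; apply: (fmorph_inj f); rewrite rmorphM rmorphXn fze -iE divfK//.
have genL2 : <<<<1; ze>>; al>>%VS = {:L}%VS.
  apply/eqP; rewrite eqEsubv subvf /= -genL; apply/Fadjoin_seqP; split=> [|r /rsE[i ->]].
    exact: sub1v.
  by rewrite rpredM ?rpredX ?memv_adjoin// (subvP (subv_adjoin _ _))// memv_adjoin.
have galL : galois 1 {:L}.
  rewrite /galois subvf normalFieldf andbT /=; apply/separableP => y _.
  by apply: pcharf0_separable => q; rewrite pchar_lalg pchar_num.
have dimL : \dim {:L} = (adjoin_degree <<1; ze>> al * adjoin_degree 1 ze)%N.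
  by rewrite -genL2 !dim_Fadjoin dimv1 muln1.
rewrite -(galois_dim galL) dimv1 divn1; apply: (etrans dimL); rewrite mulnC.
congr (_ * _)%N.
  have [q [qE q_mon q_dvd]] := minCpolyP z.
  have sq : size q = (totient n).+1.
    by rewrite -(size_cyclotomic z n) -(minCpoly_cyclotomic pz) qE size_map_poly.
  have /polyOver1P[m mE] := minPolyOver 1 ze.
  apply/eqP; rewrite -eqSS -size_minPoly -sq -(size_map_poly (in_alg L) q).
  apply/eqP/eqp_size; apply/andP; split.
    apply: minPoly_dvdp; first by apply/polyOver1P; exists q.
    by rewrite -(fmorph_root f) fQ fze -qE root_minCpoly.
  rewrite mE dvdp_map -q_dvd -fQ -fze fmorph_root -mE; exact: root_minPoly.
have inE x : (x \in <<1; ze>>%VS) <-> in_adjoin z (f x).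
  split=> [/Fadjoin_polyP[q /polyOver1P[q' ->] ->]|[q qE]].
    by exists q'; rewrite -fze -fQ horner_map.
  apply/Fadjoin_polyP; exists (map_poly (in_alg L) q); first by apply/polyOver1P; exists q.
  by apply: (fmorph_inj f); rewrite -horner_map fQ fze.
have alkP k : (al ^+ k \in <<1; ze>>%VS) <-> (d %| k)%N.
  rewrite inE rmorphXn -dP; split=> [alk|[b zb bn]].
    by exists (f al ^+ k) => //; rewrite exprAC aln.
  have b0 := root_neq0 n0 bn (expf_neq0 k a0C).
  have /(prim_rootP pz)[i iE] : (f al ^+ k / b) ^+ n = 1.
    by rewrite expr_div_n exprAC aln bn divff// expf_neq0.
  rewrite -[_ ^+ k](divfK b0) iE; apply: in_adjoinM => //.
  exact/in_adjoinX/in_adjoin_id.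
set E := <<1; ze>>%AS.
apply/eqP; rewrite eqn_leq; apply/andP; split.
  have dv : minPoly E al %| 'X^d - (al ^+ d)%:P.
    apply: minPoly_dvdp; last by rewrite /root !hornerE subrr.
    by rewrite rpredB ?rpredX ?polyOverX// polyOverC; apply/alkP.
  rewrite -ltnS -size_minPoly -(size_XnsubC (al ^+ d) d0).
  by apply: dvdp_leq => //; rewrite monic_neq0// monicXnsubC.
apply: dvdn_leq; first by rewrite /adjoin_degree.
apply/alkP.
have mdv : minPoly E al %| \prod_(r <- rs) ('X - (id r)%:P).
  rewrite -prodL; apply: minPoly_dvdp.
    rewrite rpredB ?rpredX ?polyOverX// polyOverC; exact: rpred_int.
  by rewrite prodL root_prod_XsubC.
have [mk] := dvdp_prod_XsubC mdv.
rewrite eqp_monic ?monic_minPoly//; last by apply: monic_prod => i _; exact: monicXsubC.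
move=> /eqP mE; set ss := mask mk rs in mE.
have szE : size ss = adjoin_degree E al.
  by apply/eqP; rewrite -eqSS -size_minPoly mE size_prod_XsubC.
have ssE : exists i, \prod_(r <- ss) - r = ((-1) ^+ size ss * ze ^+ i) * al ^+ size ss.
  have : {subset ss <= rs} by move=> r; exact: mem_mask.
  elim: (ss) => [|r s' IH] sub.
    by exists 0%N; rewrite big_nil !expr0 !mulr1.
  have [i0 rE] := rsE r (sub r (mem_head _ _)).
  have [i iE] := IH (fun x xs => sub x (mem_behead (s := r :: s') xs)).
  by exists (i0 + i)%N; rewrite big_cons iE rE /= !exprS exprD; ring.
have [i iE] := ssE.
have : (minPoly E al).[0] \in E.
  by apply: rpred_horner; [exact: minPolyOver|exact: rpred0].
rewrite mE horner_prod; under eq_bigr do rewrite hornerXsubC sub0r.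
rewrite iE szE fpredMl//.
- by rewrite rpredM ?rpredX ?rpredN1// memv_adjoin.
- rewrite mulf_neq0 ?expf_neq0 ?oppr_eq0 ?oner_eq0//.
  by rewrite -(fmorph_eq0 f) fze (root_neq0 n0 zn (oner_neq0 _)).
Qed.

End RadicalExtension.

(** * Exponents for which a power is an n-th power *)

(** From [k u = l v + 1] one gets [b = (q ^ u / b ^ v) ^ l]. *)
Lemma coprime_power_root (b q k l : nat) : (0 < b)%N -> (0 < l)%N -> coprime k l ->
  (b ^ k = q ^ l)%N -> exists r, b = (r ^ l)%N.
Proof.
move=> b0 l0 ckl E.
have [k0|k0] := posnP k.
  by exists b; move: ckl; rewrite k0 /coprime gcd0n => /eqP ->; rewrite expn1.
have [u v uv _] := egcdnP l k0; rewrite (eqP ckl) in uv.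
have E2 : ((b ^ v) ^ l * b = (q ^ u) ^ l)%N.
  by rewrite -[X in (_ * X)%N]expn1 -!expnM -expnD -uv mulnC expnM E -expnM mulnC.
have /dvdnP[r rE] : (b ^ v %| q ^ u)%N.
  by rewrite -(dvdn_pexp2r _ _ l0) -E2 dvdn_mulr.
exists r; apply/eqP; rewrite -(@eqn_pmul2l ((b ^ v) ^ l)) ?expn_gt0 ?b0//.
by rewrite E2 rE expnMn mulnC.
Qed.

(** Division of [k] and [l] by their greatest common divisor reduces this to
    coprime exponents, where [b] is an [l]-th power and so [l] is [1]. *)
Lemma power_exponent_dvd (b q k l : nat) : (1 < b)%N -> (0 < l)%N ->
  (forall r j, b = (r ^ j)%N -> j = 1%N) -> (b ^ k = q ^ l)%N -> (l %| k)%N.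
Proof.
move=> b1 l0 bprim E; set g := gcdn k l.
have g0 : (0 < g)%N by rewrite gcdn_gt0 l0 orbT.
have kE : k = (k %/ g * g)%N by rewrite divnK// dvdn_gcdl.
have lE : l = (l %/ g * g)%N by rewrite divnK// dvdn_gcdr.
have l1 : (0 < l %/ g)%N by rewrite divn_gt0// dvdn_leq// dvdn_gcdr.
have ckl : coprime (k %/ g) (l %/ g).
  by rewrite /coprime -(eqn_pmul2r g0) muln_gcdl -kE -lE mul1n.
have E1 : (b ^ (k %/ g) = q ^ (l %/ g))%N.
  by apply/eqP; rewrite -(eqn_exp2r _ _ g0) -!expnM -kE -lE E.
have [r rE] := coprime_power_root (ltnW b1) l1 ckl E1.
by rewrite lE (bprim _ _ rE) mul1n dvdn_gcdl.
Qed.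

Lemma sqfree_decomposition (a0 : int) : a0 != 0 ->
  exists m c : int, [/\ a0 = m * c ^+ 2, sqfree m, m != 0 & c != 0].
Proof.
move: {2}`|a0|%N (leqnn `|a0|) => N; elim: N a0 => [|N IH] a0 aN a00.
  by move: aN; rewrite leqn0 absz_eq0 (negbTE a00).
have [sq|] := pselect (sqfree a0).
  by exists a0, 1; rewrite expr1n mulr1 a00 oner_eq0.
move=> /existsNP[p] /not_implyP[pp /negP/negPn pa].
have /dvdzP[a1 a1E] : (((p ^ 2)%N%:Z : int) %| a0)%Z by rewrite dvdzE absz_nat.
have a10 : a1 != 0 by apply: contraNneq a00 => a10; rewrite a1E a10 mul0r.
have [||m [c [mE sq m0 c0]]] := IH a1 => //.
  rewrite -ltnS (leq_trans _ aN)// a1E abszM absz_nat ltn_Pmulr ?absz_gt0//.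
  by rewrite -[1%N]/(1 ^ 2)%N ltn_exp2r// prime_gt1.
exists m, (c * p%:Z); split=> //; last by rewrite mulf_neq0// -lt0n prime_gt0.
by rewrite a1E mE -mulnn PoszM; ring.
Qed.

Lemma in_adjoin_comm n z x (mu nu : {rmorphism algC -> algC}) :
  n.-primitive_root z -> in_adjoin z x -> mu (nu x) = nu (mu x).
Proof.
move=> pz [p ->]; have zn := prim_expr_order pz.
have [i iE] : exists i : nat, mu z = z ^+ i.
  have /(prim_rootP pz)[i ->] : mu z ^+ n = 1 by rewrite -rmorphXn zn rmorph1.
  by exists i.
have [j jE] : exists j : nat, nu z = z ^+ j.
  have /(prim_rootP pz)[j ->] : nu z ^+ n = 1 by rewrite -rmorphXn zn rmorph1.
  by exists j.
by rewrite !aut_horner_rat iE jE !rmorphXn /= iE jE -!exprM mulnC.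
Qed.

Lemma in_adjoin_aut_stable n z x (nu : {rmorphism algC -> algC}) :
  n.-primitive_root z -> in_adjoin z x -> in_adjoin z (nu x).
Proof.
move=> pz [p ->]; have zn := prim_expr_order pz.
have /(prim_rootP pz)[i iE] : nu z ^+ n = 1 by rewrite -rmorphXn zn rmorph1.
rewrite aut_horner_rat iE.
by apply: (@in_adjoin_trans (z ^+ i)); [exact/in_adjoinX/in_adjoin_id|exists p].
Qed.

(** Every automorphism multiplies [ga] by a root of unity [chi], and it
    multiplies the conjugate of [ga] by the conjugate of [chi], since it
    commutes with complex conjugation on the abelian field [Q(z)]. *)
Lemma cyclotomic_radical_norm_rat n z (ga : algC) (c : algC) : n.-primitive_root z ->
  in_adjoin z ga -> c \in Crat -> ga ^+ n = c -> ga * ga^* \in Crat.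
Proof.
move=> pz Kga cQ gan; have n0 := prim_order_gt0 pz.
have [ga0|ga0] := eqVneq ga 0; first by rewrite ga0 mul0r rpred0.
apply: (fixed_adjoin_rat pz).
  by apply: in_adjoinM => //; exact: (in_adjoin_aut_stable _ pz Kga).
move=> nu; rewrite rmorphM /= -[nu ga^*]/(nu (Num.conj ga)).
rewrite (in_adjoin_comm nu _ pz Kga).
pose chi := nu ga / ga; have -> : nu ga = chi * ga by rewrite divfK.
have chin : chi ^+ n = 1.
  by rewrite expr_div_n -rmorphXn gan (aut_Crat nu cQ) divff// -gan expf_neq0.
rewrite rmorphM /= mulrACA -normCK.
have -> : `|chi| = 1 by apply/eqP; rewrite -(@pexpr_eq1 _ _ n)// -normrX chin normr1.
by rewrite expr1n mul1r.
Qed.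

(** When [e] is the largest exponent for which [|a|] is an [e]-th power, this
    is the least [k > 0] such that [a ^ k] is the [n]-th power of a rational.
    The condition for [|a| ^ k] is that [n] divides [k e]; for negative [a] and
    even [n] the exponent [k] must also be even. *)
Definition rational_index (a : int) (e n : nat) : nat :=
  let n1 := (n %/ gcdn n e)%N in
  if [&& a < 0, ~~ odd n & odd n1] then n1.*2 else n1.

Section Index.
Variables (a a0 : int) (e : nat).
Hypothesis a2 : (1 < `|a|)%N.
Hypothesis e0 : (0 < e)%N.
Hypothesis emax : forall k : nat, (0 < k)%N -> perfect_power `|a|%N k -> (k <= e)%N.
Hypothesis a0e : (`|a| = `|a0| ^ e)%N.

Lemma base_gt1 : (1 < `|a0|)%N.
Proof.
by move: a2; rewrite a0e; case: `|a0|%N => [|[|]] //; rewrite ?exp0n ?exp1n.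
Qed.

Lemma base_not_power r j : `|a0|%N = (r ^ j)%N -> j = 1%N.
Proof.
move=> rj; have j0 : (0 < j)%N.
  by rewrite lt0n; apply/eqP => j0; have := base_gt1; rewrite rj j0.
have : (j * e <= e)%N.
  by apply: emax; [rewrite muln_gt0 j0|exists r; rewrite a0e rj expnM].
by rewrite -{2}[e]mul1n leq_pmul2r//; case: j j0 {rj} => [|[|]].
Qed.

Lemma abs_power_dvd (q n k : nat) : (0 < n)%N -> (q ^ n = `|a| ^ k)%N -> (n %| k * e)%N.
Proof.
move=> n0 E; apply: (power_exponent_dvd base_gt1 n0 base_not_power (q := q)).
by rewrite E a0e -expnM mulnC.
Qed.

Lemma rational_power_abs n k (b : algC) : (0 < n)%N -> b \in Crat ->
  b ^+ n = a%:~R ^+ k -> exists2 q : int, b = q%:~R & q ^+ n = a ^+ k.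
Proof.
move=> n0 bQ bn; have /intrP[q qE] : b \in Num.int.
  by apply: (rat_root_int n0 bQ); rewrite bn rpredX// rpred_int.
by exists q => //; apply: (@intr_inj algC); rewrite !rmorphXn -bn qE.
Qed.

Lemma rational_powerP n k : (0 < n)%N ->
  (exists2 b : algC, b \in Crat & b ^+ n = a%:~R ^+ k) <->
  (n %| k * e)%N /\ (a < 0 -> ~~ odd n -> ~~ odd k).
Proof.
move=> n0; split=> [[b bQ bn]|[/dvdnP[j jE] par]].
  have [q _ qn] := rational_power_abs n0 bQ bn; split.
    by apply: (@abs_power_dvd `|q|%N) => //; rewrite -!abszX qn.
  move=> aneg en; apply/negP => ok.
  have : 0 <= q ^+ n by rewrite exprn_even_ge0.
  by rewrite qn leNgt exprn_odd_lt0// aneg.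
have absE : `|a| ^+ k = (`|a0|%N%:Z ^+ j) ^+ n :> int.
  by rewrite -abszE a0e -!natz natrX -!exprM mulnC jE.
suff [q qn] : exists q : int, q ^+ n = a ^+ k.
  by exists q%:~R; rewrite ?rpred_int// -!rmorphXn qn.
have [a_ge0|aneg] := leP 0 a; first by exists (`|a0|%N%:Z ^+ j); rewrite -absE ger0_norm.
have aE : a = - `|a| by rewrite ltr0_norm// opprK.
have akE : a ^+ k = (-1) ^+ odd k * `|a| ^+ k by rewrite signr_odd -exprNn -aE.
have [ok|ek] := boolP (odd k); last first.
  by exists (`|a0|%N%:Z ^+ j); rewrite -absE akE (negbTE ek) mul1r.
have on : odd n by apply: contraT => en; rewrite (negbTE (par aneg en)) in ok.
exists (- `|a0|%N%:Z ^+ j).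
by rewrite exprNn -absE akE ok -signr_odd on.
Qed.

Lemma rational_index_gt0 n : (0 < n)%N -> (0 < rational_index a e n)%N.
Proof.
move=> n0; have d0 : (0 < n %/ gcdn n e)%N.
  by rewrite divn_gt0 ?gcdn_gt0 ?n0// dvdn_leq// dvdn_gcdl.
by rewrite /rational_index; case: ifP; rewrite ?double_gt0.
Qed.

Lemma dvdn_mul_gcd n k : (0 < n)%N -> (n %| k * e)%N = (n %/ gcdn n e %| k)%N.
Proof.
move=> n0; have g0 : (0 < gcdn n e)%N by rewrite gcdn_gt0 n0.
have nE : n = (n %/ gcdn n e * gcdn n e)%N by rewrite divnK// dvdn_gcdl.
have eE : e = (e %/ gcdn n e * gcdn n e)%N by rewrite divnK// dvdn_gcdr.
have -> : (n %| k * e)%N =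
    (n %/ gcdn n e * gcdn n e %| k * (e %/ gcdn n e * gcdn n e))%N by rewrite -nE -eE.
rewrite mulnA dvdn_pmul2r// Gauss_dvdl//.
by rewrite /coprime -(eqn_pmul2r g0) muln_gcdl -nE -eE mul1n.
Qed.

Lemma rational_indexP n k : (0 < n)%N ->
  (exists2 b : algC, b \in Crat & b ^+ n = a%:~R ^+ k) <->
  (rational_index a e n %| k)%N.
Proof.
move=> n0; rewrite rational_powerP// dvdn_mul_gcd// /rational_index.
set n1 := (n %/ _)%N; case: ifP => [/and3P[an en on1]|].
  rewrite -mul2n Gauss_dvd ?coprime2n// dvdn2.
  by split=> [[-> /(_ an en) ->]//|/andP[-> ->]].
move=> H; split=> [[]//|n1k]; split=> // an en; move: H; rewrite an en /= => /negbT en1.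
by apply: contra en1 => ok; apply: dvdn_odd n1k ok.
Qed.

(** The conditions of [rational_powerP] hold for [m * n] exactly if they hold
    for [m] and for [n], so the index of [m * n] is a least common multiple;
    and each index divides its modulus. *)
Lemma rational_indexM m n : (0 < m)%N -> (0 < n)%N -> coprime m n ->
  rational_index a e (m * n) = (rational_index a e m * rational_index a e n)%N.
Proof.
move=> m0 n0 cmn; have mn0 : (0 < m * n)%N by rewrite muln_gt0 m0.
have dvd_index k : (0 < k)%N -> (rational_index a e k %| k)%N.
  move=> k0; apply/rational_indexP => //; exists a%:~R => //; exact: rpred_int.
have cd : coprime (rational_index a e m) (rational_index a e n).
  by apply: (coprime_dvdl (dvd_index _ m0)); apply: (coprime_dvdr (dvd_index _ n0)).
have key k : (rational_index a e (m * n) %| k)%N =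
    (rational_index a e m * rational_index a e n %| k)%N.
  rewrite Gauss_dvd//; apply/idP/andP => [/rational_indexP|[]].
    rewrite rational_powerP// Gauss_dvd// oddM => /(_ mn0)[/andP[mk nk] par].
    split; apply/rational_indexP => //; rewrite rational_powerP//; split=> // an en.
      by apply: par => //; rewrite (negbTE en).
    by apply: par => //; rewrite (negbTE en) andbF.
  move=> /rational_indexP; rewrite rational_powerP// => /(_ m0)[mk pm].
  move=> /rational_indexP; rewrite rational_powerP// => /(_ n0)[nk pn].
  apply/rational_indexP => //; rewrite rational_powerP//; rewrite Gauss_dvd// mk nk.
  split=> // an; rewrite oddM negb_and => /orP[]; [exact: pm|exact: pn].
by apply/eqP; rewrite eqn_dvd key dvdnn -key dvdnn.
Qed.

(** The squared modulus of [ga] is a rational number whose [n]-th power is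
    [a ^+ k.*2]. *)
Lemma cyclotomic_power_double n z k (ga : algC) : n.-primitive_root z ->
  in_adjoin z ga -> ga ^+ n = a%:~R ^+ k -> (rational_index a e n %| k.*2)%N.
Proof.
move=> pz Kga gan; have n0 := prim_order_gt0 pz.
have akQ : a%:~R ^+ k \in Crat by rewrite rpredX// rpred_int.
have qQ := cyclotomic_radical_norm_rat pz Kga akQ gan.
apply/rational_indexP => //; exists (ga * ga^*) => //.
rewrite exprMn -rmorphXn gan /= -mul2n mulnC exprM expr2; congr (_ * _).
exact: conj_Crat.
Qed.

(** In this case some power of [a] becomes an [n]-th power in [Q(z)] before any
    does in the rationals, and [#G(n)] is half of [#A(n)]. *)
Definition entangled (n : nat) (z : algC) : Prop :=
  (2 %| rational_index a e n)%N /\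
  exists2 ga, in_adjoin z ga & ga ^+ n = a%:~R ^+ (rational_index a e n)./2.

(** The exponents [k] on the left form a group.  It contains the multiples of
    [rational_index a e n], and twice any of its elements is such a multiple. *)
Lemma cyclotomic_indexP n z d : n.-primitive_root z ->
  (entangled n z -> d = (rational_index a e n)./2) ->
  (~ entangled n z -> d = rational_index a e n) ->
  forall k : nat,
  (exists2 b : algC, in_adjoin z b & b ^+ n = a%:~R ^+ k) <-> (d %| k)%N.
Proof.
move=> pz dent dnent k; have n0 := prim_order_gt0 pz.
have aC0 : a%:~R != 0 :> algC by rewrite intr_eq0 -absz_gt0 (ltn_trans _ a2).
have ratK j : (rational_index a e n %| j)%N ->
    exists2 b : algC, b \in Crat & b ^+ n = a%:~R ^+ j.
  by move/rational_indexP; apply.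
have halfE : (2 %| rational_index a e n)%N ->
    rational_index a e n = ((rational_index a e n)./2 * 2)%N.
  by rewrite dvdn2 => en; rewrite muln2 -{1}(odd_double_half (rational_index a e n)) (negbTE en).
split=> [[ga Kga gan]|].
  have [dk|ndk] := boolP (rational_index a e n %| k)%N.
    have [E|E] := pselect (entangled n z); last by rewrite dnent.
    by rewrite dent//; apply: dvdn_trans dk; rewrite {2}halfE ?dvdn_mulr//; case: E.
  suff E : entangled n z.
    rewrite dent//; have := cyclotomic_power_double pz Kga gan.
    by rewrite {1}(halfE E.1) -muln2 dvdn_pmul2r.
  have d2k := cyclotomic_power_double pz Kga gan.
  have de : (2 %| rational_index a e n)%N.
    rewrite dvdn2; apply: contra ndk => od.
    by move: d2k; rewrite -mul2n Gauss_dvdr// coprimen2.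
  split=> //; move: (halfE de) d2k ndk; set h := _./2 => -> d2k ndk.
  have {d2k}/dvdnP[j jE] : (h %| k)%N by move: d2k; rewrite -muln2 dvdn_pmul2r.
  have oj : odd j.
    apply: contraR ndk => ej; rewrite jE mulnC dvdn_mul//.
    by rewrite dvdn2.
  have [b bQ bn] : exists2 b : algC, b \in Crat & b ^+ n = a%:~R ^+ (j./2 * (h * 2)).
    by apply: ratK; rewrite -halfE// dvdn_mull.
  have b0 := root_neq0 n0 bn (expf_neq0 _ aC0).
  exists (ga * b^-1).
    by apply: in_adjoinM => //; apply: in_adjoin_rat; rewrite rpredV.
  rewrite exprMn exprVn gan bn; have -> : k = (h + j./2 * (h * 2))%N.
    by rewrite jE -{1}(odd_double_half j) oj -muln2; lia.
  by rewrite exprD mulfK// expf_neq0.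
have [E|E] := pselect (entangled n z).
  rewrite dent// => /dvdnP[j ->]; have [_ [ga Kga gan]] := E.
  exists (ga ^+ j); first exact: in_adjoinX.
  by rewrite exprAC gan -exprM mulnC.
rewrite dnent// => /ratK[b bQ bn]; exists b => //; exact: in_adjoin_rat.
Qed.

End Index.

(** * Entanglement in terms of prime exponents *)

Lemma even_neq1 (m : int) : (2 %| `|m|)%N -> (m == 1 %[mod 4])%Z = false.
Proof. by move=> m2; apply/negbTE; lia. Qed.

Section Conductor.
Variables (a m : int) (e : nat).
Hypothesis sqm : sqfree m.
Hypothesis m0 : m != 0.
Local Notation D := (quadratic_disc m).
Local Notation w := (logn 2 e).
Local Notation s := (s_exp a e).

Lemma ell_odd p : prime p -> odd p -> ell a e D p = (p %| `|m|)%N.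
Proof.
move=> pp op; rewrite /ell op -[RHS]/(nat_of_bool (p%:Z %| m)%Z).
suff -> : (p%:Z %| D)%Z = (p%:Z %| m)%Z by case: (_ %| _)%Z.
rewrite /quadratic_disc; case: ifP => // _; rewrite !dvdzE abszM Gauss_dvdr//.
by rewrite coprime_sym (@coprimeXl 2 2)// coprime2n.
Qed.

Lemma ell_two : ell a e D 2 =
  if (m == 1 %[mod 4])%Z then s
  else if ~~ (2 %| `|m|)%N then maxn 2 s
  else if (w == 1)%N && (a < 0) then 2 else maxn 3 s.
Proof.
have m4 : ~~ (4 %| `|m|)%N := sqm (p := 2) isT.
rewrite /ell /exactly_divides /quadratic_disc /=.
have -> : (2 ^ 2)%N = 4 by []. have -> : (2 ^ 3)%N = 8 by [].
have -> : (2 ^ 4)%N = 16 by [].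
case: (boolP (m == 1 %[mod 4])%Z) => m1; first by have -> : (2 %| m)%Z = false by apply/negbTE; lia.
have -> : (2 %| 4 * m)%Z = true by lia.
have -> : (4 %| 4 * m)%Z = true by lia.
have [m2|m2] := boolP (2 %| `|m|)%N; last first.
  by have -> : (8 %| 4 * m)%Z = false by apply/negbTE; lia.
have -> : (8 %| 4 * m)%Z = true by lia.
by have -> : (16 %| 4 * m)%Z = false by apply/negbTE; lia.
Qed.

Lemma ell_leP n : (0 < n)%N ->
  (forall p, prime p -> (ell a e D p <= logn p n)%N) <->
  (forall p, prime p -> odd p -> (p %| `|m|)%N -> (p %| n)%N) /\
  (ell a e D 2 <= logn 2 n)%N.
Proof.
move=> n0; have dvd_log p : prime p -> (0 < logn p n)%N = (p %| n)%N.
  by move=> pp; rewrite logn_gt0 mem_primes pp n0.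
split=> [H|[H1 H2] p pp].
  split; last exact: H.
  by move=> p pp op pm; rewrite -dvd_log//; have := H p pp; rewrite ell_odd// pm.
have [p2|op] := even_prime pp; first by rewrite p2.
by rewrite ell_odd//; case: (boolP (p %| `|m|)%N) => // pm; rewrite dvd_log// H1.
Qed.

Lemma s_exp_gt0 : (0 < s)%N.
Proof. by rewrite /s_exp; case: ifP. Qed.

Lemma ell_two_gt0 : (0 < ell a e D 2)%N.
Proof. by rewrite ell_two; do !case: ifP => _ //; rewrite ?leq_max ?s_exp_gt0. Qed.

(** In the excluded case [ell] takes the value [2] at the prime [2], although
    [n] need not be divisible by [8] as the discriminant is. *)
Lemma conductor_ell n : (0 < n)%N -> (s <= logn 2 n)%N ->
  ~~ [&& w == 1%N, a < 0 & (2 %| `|m|)%N] || (2 < logn 2 n)%N ->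
  conductor_dvd m n <-> (forall p, prime p -> (ell a e D p <= logn p n)%N).
Proof.
move=> n0 sn H; rewrite ell_leP// ell_two.
have d4 : (4 %| n)%N = (1 < logn 2 n)%N by rewrite -[LHS]/(2 ^ 2 %| n)%N pfactor_dvdn.
have d8 : (8 %| n)%N = (2 < logn 2 n)%N by rewrite -[LHS]/(2 ^ 3 %| n)%N pfactor_dvdn.
split=> [[mp m3 m8]|[mp]].
  split=> //; case: ifP => m1 //; case: ifP => m2.
    by rewrite geq_max sn -d4 m3//; lia.
  have n8 : (8 %| n)%N by apply: m8; apply: negbFE.
  by case: ifP => _; rewrite ?geq_max ?sn -?d4 -?d8 ?n8//; lia.
move=> E; split=> // [m3|m2].
  move: E; have -> : (m == 1 %[mod 4])%Z = false by apply/negbTE; lia.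
  have -> : ~~ (2 %| `|m|)%N by lia.
  by rewrite geq_max -d4 => /andP[].
move: E; have -> : (m == 1 %[mod 4])%Z = false by apply/negbTE; lia.
rewrite d8 m2 /=; move: H; rewrite m2 andbT.
by case: ifP => //= _ _; rewrite geq_max => /andP[].
Qed.

End Conductor.

Section Entangled.
Variables (a a0 m c : int) (e : nat).
Hypothesis a2 : (1 < `|a|)%N.
Hypothesis e0 : (0 < e)%N.
Hypothesis a0e : (`|a| = `|a0| ^ e)%N.
Hypothesis sgn : sgz a0 = sgz a.
Hypothesis a0m : a0 = m * c ^+ 2.
Hypothesis sqm : sqfree m.
Hypothesis m0 : m != 0.
Hypothesis c0 : c != 0.

Variables (n : nat) (z : algC).
Hypothesis pz : n.-primitive_root z.
Let n0 : (0 < n)%N := prim_order_gt0 pz.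
Let zn : z ^+ n = 1 := prim_expr_order pz.
Local Notation v := (logn 2 n).
Local Notation w := (logn 2 e).
Local Notation g := (gcdn n e).
Local Notation n1 := (n %/ g)%N.
Local Notation e1 := (e %/ g)%N.

Let t : algC := sqrtC m%:~R.
Let tm : t ^+ 2 = m%:~R := sqrtCK _.
Let s : algC := c%:~R * t.
Let s2 : s ^+ 2 = a0%:~R.
Proof. by rewrite exprMn tm a0m rmorphM rmorphXn mulrC. Qed.

Let g0 : (0 < g)%N. Proof. by rewrite gcdn_gt0 n0. Qed.
Let nE : n = (n1 * g)%N. Proof. by rewrite divnK// dvdn_gcdl. Qed.
Let eE : e = (e1 * g)%N. Proof. by rewrite divnK// dvdn_gcdr. Qed.
Let n10 : (0 < n1)%N. Proof. by rewrite divn_gt0// dvdn_leq// dvdn_gcdl. Qed.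
Let e10 : (0 < e1)%N. Proof. by rewrite divn_gt0// dvdn_leq// dvdn_gcdr. Qed.

Let logg : logn 2 g = minn v w.
Proof. by rewrite logn_gcd. Qed.

Lemma log_index : logn 2 n1 = (v - w)%N.
Proof.
have := congr1 (logn 2) nE; rewrite [in RHS]lognM// logg; lia.
Qed.

Lemma odd_index : odd n1 = (v <= w)%N.
Proof.
have := dvdn2 n1; rewrite -[2%N]/(2 ^ 1)%N pfactor_dvdn// log_index subn_gt0.
by rewrite ltnNge => /negb_inj ->.
Qed.

Lemma odd_cofactor : (w <= v)%N -> odd e1.
Proof.
move=> wv; have e1l : logn 2 e1 = (w - minn v w)%N.
  have := congr1 (logn 2) eE; rewrite [in RHS]lognM// logg; lia.
have := dvdn2 e1; rewrite -[2%N]/(2 ^ 1)%N pfactor_dvdn// e1l.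
by move/esym/(congr1 negb); rewrite negbK => ->; lia.
Qed.

Lemma in_adjoin_ratM (r x : algC) : r \in Crat -> r != 0 ->
  in_adjoin z (r * x) <-> in_adjoin z x.
Proof.
move=> rQ r0; split=> K; last by apply: in_adjoinM => //; exact: in_adjoin_rat.
by rewrite -(mulKf r0 x); apply: in_adjoinM => //; apply: in_adjoin_rat; rewrite rpredV.
Qed.

Lemma adjoin_root_iff (x y : algC) : x ^+ n = y -> y != 0 ->
  (exists2 ga, in_adjoin z ga & ga ^+ n = y) <-> in_adjoin z x.
Proof.
move=> xn y0; split=> [[ga Kga gan]|K]; last by exists x.
have ga0 := root_neq0 n0 gan y0.
have /(prim_rootP pz)[i iE] : (x / ga) ^+ n = 1 by rewrite expr_div_n xn gan divff.
by rewrite -(divfK ga0 x) iE; apply: in_adjoinM => //; exact/in_adjoinX/in_adjoin_id.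
Qed.

Lemma in_adjoin_odd_power (x : algC) k : odd k ->
  in_adjoin z (x * s ^+ k) <-> in_adjoin z (x * t).
Proof.
move=> ok; pose r : algC := c%:~R * a0%:~R ^+ k./2.
have a00 : a0 != 0 by rewrite a0m mulf_neq0// expf_neq0.
have -> : x * s ^+ k = r * (x * t).
  rewrite -{1}(odd_double_half k) ok -mul2n exprD expr1 exprM s2 /r /s; ring.
apply: in_adjoin_ratM; first by rewrite rpredM ?rpredX ?rpred_int.
by rewrite mulf_neq0 ?expf_neq0 ?intr_eq0.
Qed.

(** Raising to the power [n + 1] fixes [z] and negates [om]. *)
Lemma unity_root_neg_notin (om : algC) : ~~ odd n -> om ^+ n = -1 -> ~ in_adjoin z om.
Proof.
move=> en omn K; have om2n : om ^+ (2 * n) = 1 by rewrite mulnC exprM omn sqrrN expr1n.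
have cu : coprime n.+1 (2 * n) by rewrite coprimeMr coprimen2 /= en coprimeSn.
have [nu nuE] := Qn_aut_exists cu.
have nuz : nu z = z.
  by rewrite nuE ?exprS ?zn ?mulr1// mulnC exprM zn expr1n.
have := in_adjoin_aut nuz K; rewrite nuE// exprS omn mulrN1 => /eqP.
rewrite -subr_eq0 -opprD oppr_eq0 -mulr2n mulrn_eq0 /=; apply/negP.
by apply: (root_neq0 n0 omn); rewrite oppr_eq0 oner_eq0.
Qed.

Let aC0 : a%:~R != 0 :> algC.
Proof. by rewrite intr_eq0 -absz_gt0 (ltn_trans _ a2). Qed.

Let exponent_swap k : (e * (n1 * k) = e1 * k * n)%N.
Proof.
transitivity (e1 * g * (n1 * k))%N; first by rewrite -eE.
by transitivity (e1 * k * (n1 * g))%N; [ring|rewrite -nE].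
Qed.

Local Notation d := (rational_index a e n).
Local Notation ramified := (forall p, prime p -> (ell a e (quadratic_disc m) p <= logn p n)%N).

(** As [2 * (e * n1./2) = e1 * n] with [e1] odd, an [n]-th root of [a ^+ n1./2]
    is [x * s ^+ e1], which is a rational multiple of [x * t].  The factor [x]
    absorbs the sign by which [a ^+ n1./2] and [a0 ^+ (e * n1./2)] differ. *)
Lemma half_power (x : algC) : (w < v)%N -> x ^+ n * a0%:~R ^+ (e * n1./2) = a%:~R ^+ n1./2 ->
  (exists2 ga, in_adjoin z ga & ga ^+ n = a%:~R ^+ n1./2) <-> in_adjoin z (x * t).
Proof.
move=> wv xE; have en1 : ~~ odd n1 by rewrite odd_index -ltnNge.
rewrite -(in_adjoin_odd_power x (odd_cofactor (ltnW wv))).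
apply: adjoin_root_iff; last exact: expf_neq0.
rewrite -xE exprMn -s2 -!exprM; congr (_ * _ ^+ _).
have n1E : n1 = (n1./2 * 2)%N by rewrite muln2 -{1}(odd_double_half n1) (negbTE en1).
by rewrite [(2 * _)%N]mulnC -mulnA -n1E -[n1]muln1 exponent_swap muln1.
Qed.

Lemma base_power : a0 ^+ e = if (a < 0) && ~~ odd e then - a else a.
Proof.
have absE : `|a0| ^+ e = `|a| :> int by rewrite -!abszE a0e -!natz natrX.
have [a_lt0|a_gt0|a_0] := ltgtP a 0; last by move: a2; rewrite a_0.
- have a0_lt0 : a0 < 0 by rewrite -sgz_lt0 sgn sgz_lt0.
  rewrite ltr0_norm// in absE; rewrite (ltr0_norm a_lt0) exprNn in absE.
  rewrite -[a0 ^+ e](signrMK e) absE -signr_odd; case: (odd e) => /=.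
    by rewrite expr1 mulN1r opprK.
  by rewrite expr0 mul1r.
- have a0_gt0 : 0 < a0 by rewrite -sgz_gt0 sgn sgz_gt0.
  by rewrite -[in LHS](gtr0_norm a0_gt0) absE gtr0_norm.
Qed.

Lemma le_ell_two : ~~ [&& w == 1%N, a < 0 & (2 %| `|m|)%N] ->
  (s_exp a e <= ell a e (quadratic_disc m) 2)%N.
Proof.
move=> H; rewrite ell_two//; case: ifP => // _; case: ifP => [_|/negbFE m2].
  exact: leq_maxr.
by move: H; rewrite m2 andbT => /negbTE ->; exact: leq_maxr.
Qed.

(** For odd [n] the index is odd; let [n] be even.  If [a > 0] or [e] is odd,
    then [a = a0 ^+ e]; the index is even exactly for [w < v], and the question
    is whether [t] lies in [Q(z)].  If [a < 0] and [e] is even, then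
    [a = - a0 ^+ e], and there are three ranges: for [v <= w] an [n]-th root of
    the half power is rational up to a root [om] of [x ^+ n = -1], which is not
    in [Q(z)]; for [v = w + 1] it is a rational multiple of [om * t]; for
    larger [v] it is again a rational multiple of [t]. *)
Lemma entangledP : entangled a e n z <-> ramified.
Proof.
have logpos : (0 < v)%N = ~~ odd n.
  by rewrite -(pfactor_dvdn 1 _ n0)// expn1 dvdn2.
have dE : d = if [&& a < 0, ~~ odd n & odd n1] then n1.*2 else n1 by [].
have unram k : (k <= ell a e (quadratic_disc m) 2)%N -> (v < k)%N -> ~ ramified.
  by move=> ek vk /(_ 2%N isT) /(leq_trans ek); rewrite leqNgt vk.
have unent : odd d -> ~ entangled a e n z.
  by move=> od [+ _]; rewrite dvdn2 od.
have [on|en] := boolP (odd n).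
  have v0 : v = 0%N by apply/eqP; rewrite eqn0Ngt logpos on.
  have od : odd d by rewrite dE on andbF odd_index v0.
  split=> [/(unent od)//|]; move=> H; exfalso; move: H; apply: (unram 1%N); last by rewrite v0.
  exact: ell_two_gt0.
have v0 : (0 < v)%N by rewrite logpos.
have tP : in_adjoin z (1 * t) <-> conductor_dvd m n.
  by rewrite mul1r; exact: sqrt_in_cyclotomicP.
have entE (wv : (w < v)%N) : entangled a e n z <->
    exists2 ga, in_adjoin z ga & ga ^+ n = a%:~R ^+ n1./2.
  have en1 : ~~ odd n1 by rewrite odd_index -ltnNge.
  have dn1 : d = n1 by rewrite dE (negbTE en1) !andbF.
  by rewrite /entangled dn1 dvdn2 en1; split=> [[]|].
have [/andP[aneg ee]|caseI] := boolP ((a < 0) && ~~ odd e); last first.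
  have sE : s_exp a e = w.+1.
    rewrite /s_exp; case: (boolP (odd e || (0 < a))) => // H; case/negP: caseI.
    move: H; rewrite negb_or => /andP[-> ]; rewrite -leNgt andbT le_eqVlt => /orP[/eqP a_0|//].
    by move: a2; rewrite a_0.
  have w0 : a < 0 -> w = 0%N.
    move=> aneg; move: caseI; rewrite aneg /= negbK => oe.
    by apply/eqP; rewrite eqn0Ngt -(pfactor_dvdn 1 _ e0)// expn1 dvdn2 oe.
  have exc : ~~ [&& w == 1%N, a < 0 & (2 %| `|m|)%N].
    by apply/negP => /and3P[/eqP w1 /w0]; rewrite w1.
  have [vw|wv] := leqP v w.
    have od : odd d.
      rewrite dE odd_index vw andbT; case: ifP => [/andP[/w0 w_0]|_].
        by move: vw; rewrite w_0 leqNgt v0.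
      by rewrite odd_index.
    split=> [/(unent od)//|]; move=> H; exfalso; move: H.
    apply: (unram (s_exp a e)); first exact: le_ell_two.
    by rewrite sE.
  rewrite entE// (@half_power 1)//; last first.
    by rewrite expr1n mul1r exprM -rmorphXn base_power (negbTE caseI).
  by rewrite tP; apply: conductor_ell; rewrite ?sE ?exc.
have aP : a%:~R = - a0%:~R ^+ e :> algC.
  by rewrite -rmorphXn base_power aneg ee /= rmorphN opprK.
have sE : s_exp a e = w.+2.
  by rewrite /s_exp (negbTE ee) /= ltNge (ltW aneg).
have w0 : (0 < w)%N by rewrite -(pfactor_dvdn 1 _ e0)// expn1 dvdn2.
pose om : algC := n.-root (-1); have omn : om ^+ n = -1 by exact: rootCK.
have a00 : a0 != 0 by rewrite a0m mulf_neq0// expf_neq0.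
have [vw|wv] := leqP v w.
  have on1 : odd n1 by rewrite odd_index.
  have dn1 : d = n1.*2 by rewrite dE aneg en on1.
  split=> [[_]|].
    rewrite dn1 doubleK (@adjoin_root_iff (a0%:~R ^+ e1 * om)) ?expf_neq0//.
      rewrite in_adjoin_ratM ?rpredX ?rpred_int ?expf_neq0 ?intr_eq0//.
      by move/(unity_root_neg_notin en omn).
    rewrite exprMn omn mulrN1 aP exprNn -signr_odd on1 expr1 mulN1r -!exprM.
    by have := exponent_swap 1; rewrite !muln1 => ->.
  have [exc|exc] := boolP [&& w == 1%N, a < 0 & (2 %| `|m|)%N]; last first.
    by move=> H; exfalso; move: H; apply: (unram (s_exp a e)); [exact: le_ell_two|rewrite sE; lia].
  move: exc => /and3P[/eqP w1 _ m2] H; exfalso; move: H.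
  apply: (unram 2%N); last by move: vw; rewrite w1.
  by rewrite ell_two// even_neq1// m2 w1 aneg.
have en1 : ~~ odd n1 by rewrite odd_index -ltnNge.
have n1E : n1 = (n1./2 * 2)%N by rewrite muln2 -{1}(odd_double_half n1) (negbTE en1).
have h0 : (0 < n1./2)%N by move: n10; rewrite {1}n1E muln_gt0 => /andP[].
have oddh : odd n1./2 = (v == w.+1).
  have lh : (logn 2 n1./2 + 1 = v - w)%N.
    by rewrite -log_index [in RHS]n1E lognM.
  have := dvdn2 n1./2; rewrite -[2%N]/(2 ^ 1)%N pfactor_dvdn//.
  move=> /esym/(congr1 negb); rewrite negbK => ->.
  by rewrite -eqn0Ngt -(eqn_add2r 1) lh add0n -(eqn_add2r w) subnK// ltnW.
have aX : a%:~R ^+ n1./2 = (-1) ^+ odd n1./2 * a0%:~R ^+ (e * n1./2) :> algC.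
  by rewrite aP exprM signr_odd -exprNn.
rewrite entE//; have [vw|vw] := eqVneq v w.+1.
  rewrite (@half_power om)//; last by rewrite omn aX oddh vw eqxx.
  have n4 : (4 %| n)%N by rewrite -[X in (X %| _)%N]/(2 ^ 2)%N pfactor_dvdn// vw ltnS.
  rewrite (twisted_sqrt_in_cyclotomicP sqm m0 pz n4 omn tm) ell_leP//.
  have n8 : ~~ (8 %| n)%N = (w == 1)%N.
    by rewrite -[X in (X %| _)%N]/(2 ^ 3)%N pfactor_dvdn// vw -ltnNge !ltnS eqn_leq w0 andbT.
  split=> [[H m2]|[H ell2]].
    rewrite n8 => w1; split=> //; rewrite ell_two// even_neq1// m2 w1 aneg /=.
    by rewrite vw (eqP w1).
  have [/and3P[w1 _ m2]|exc] := boolP [&& w == 1%N, a < 0 & (2 %| `|m|)%N].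
    by split=> //; rewrite n8.
  by have := leq_trans (le_ell_two exc) ell2; rewrite sE vw ltnn.
rewrite (@half_power 1)//; last by rewrite expr1n mul1r aX oddh (negbTE vw) mul1r.
rewrite tP; apply: conductor_ell => //; first by rewrite sE ltn_neqAle eq_sym vw.
apply/orP; right; apply: leq_trans (_ : w.+2 <= _)%N; first by rewrite !ltnS.
by rewrite ltn_neqAle eq_sym vw.
Qed.

End Entangled.

(** * The sum over all degrees *)

Lemma cvgn_lim_add (K : numFieldType) (u v U V : nat -> K^o) :
  U @ \oo --> limn u -> V @ \oo --> limn v -> cvgn u -> cvgn v ->
  (fun N => u N + v N) @ \oo --> limn U + limn V.
Proof.
move=> Uu Vv cu cv.
rewrite (cvg_lim (@norm_hausdorff _ _) Uu) (cvg_lim (@norm_hausdorff _ _) Vv).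
exact: cvgD.
Qed.

Section Cardinals.
Variables (a a0 : int) (e : nat).
Hypothesis a2 : (1 < `|a|)%N.
Hypothesis e0 : (0 < e)%N.
Hypothesis emax : forall k : nat, (0 < k)%N -> perfect_power `|a|%N k -> (k <= e)%N.
Hypothesis a0e : (`|a| = `|a0| ^ e)%N.
Hypothesis sgn : sgz a0 = sgz a.

Lemma cardAE n : (0 < n)%N -> cardA a n = (totient n * rational_index a e n)%N.
Proof.
move=> n0; have [z pz] := C_prim_root_exists n0.
apply: (cardA_totient a2 n0 _ _ pz); first exact: rational_index_gt0.
by move=> k; exact: (rational_indexP a2 e0 emax a0e).
Qed.

Lemma cardA1 : cardA a 1 = 1%N.
Proof. by rewrite cardAE// /rational_index gcd1n /= andbF. Qed.

Lemma cardAM m n : (0 < m)%N -> (0 < n)%N -> coprime m n ->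
  cardA a (m * n) = (cardA a m * cardA a n)%N.
Proof.
move=> m0 n0 cmn; rewrite !cardAE ?muln_gt0 ?m0// totient_coprime//.
by rewrite (rational_indexM a2 e0 emax a0e)// mulnACA.
Qed.

Variables (m c : int).
Hypothesis a0m : a0 = m * c ^+ 2.
Hypothesis sqm : sqfree m.
Hypothesis m0 : m != 0.
Hypothesis c0 : c != 0.

Definition ramification_bound (n : nat) : bool :=
  `[< forall p, prime p -> (ell a e (quadratic_disc m) p <= logn p n)%N >].

Lemma cardGE n : (0 < n)%N ->
  (0 < cardG a n)%N /\
  cardA a n = (cardG a n * (if ramification_bound n then 2 else 1))%N.
Proof.
move=> n0; have [z pz] := C_prim_root_exists n0.
have aZ0 : a != 0 by rewrite -absz_gt0 (ltn_trans _ a2).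
have entP : reflect (entangled a e n z) (ramification_bound n).
  have iffE := entangledP a2 e0 a0e sgn a0m sqm m0 c0 pz.
  by apply: (iffP (asboolP _)) => /iffE.
have d0 := rational_index_gt0 a e n0.
pose d := if ramification_bound n then (rational_index a e n)./2 else rational_index a e n.
have dE : rational_index a e n = (d * (if ramification_bound n then 2 else 1))%N.
  rewrite /d; case: entP => [[dv _]|_]; last by rewrite muln1.
  move: dv; rewrite dvdn2 => od.
  by rewrite muln2 -{1}(odd_double_half (rational_index a e n)) (negbTE od).
have dpos : (0 < d)%N by move: d0; rewrite dE muln_gt0 => /andP[].
have GE : cardG a n = (totient n * d)%N.
  have dent : entangled a e n z -> d = (rational_index a e n)./2.
    by rewrite /d; case: entP.
  have dnent : ~ entangled a e n z -> d = rational_index a e n.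
    by rewrite /d; case: entP.
  exact: (cardG_totient aZ0 n0 dpos pz (cyclotomic_indexP a2 e0 emax a0e pz dent dnent)).
by rewrite GE muln_gt0 totient_gt0 n0 dpos cardAE// {1}dE mulnA.
Qed.

End Cardinals.

Theorem theorem1p2 (R : realType)
  (a : int) (ha0 : a != 0) (ha1 : a != 1) (haN1 : a != -1)
  (e : nat) (he : (0 < e)%N) (hpow : perfect_power `|a|%N e)
  (hmax : forall k : nat, (0 < k)%N -> perfect_power `|a|%N k -> (k <= e)%N)
  (a0 : int) (ha0e : (`|a|%N = `|a0|%N ^ e)%N) (hsgn : sgz a0 = sgz a)
  (K : fieldExtType rat) (r : K) (hr : r ^+ 2 = a0%:~R)
  (hK : <<1; r>>%VS = {:K}%VS)
  (D : int) (hD : is_discriminant K D)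
  (g : nat -> R[i]^o) (hg : multiplicative_arith g)
  (habs : cvgn (fun N : nat =>
     \sum_(1 <= n < N) (`|g n| / (cardG a n)%:R : R[i]^o))) :
  [/\ forall p : nat, prime p -> cvgn (local_partial a g p 0),
      cvgn (euler_partial a g (fun=> 0%N)),
      cvgn (euler_partial a g (ell a e D)) &
      (fun N : nat => \sum_(1 <= n < N) termG a g n) @ \oo -->
        limn (euler_partial a g (fun=> 0%N)) +
        limn (euler_partial a g (ell a e D))].
Proof.
have a2 : (1 < `|a|)%N by lia.
have a00 : a0 != 0.
  by apply/eqP => a00; move: a2; rewrite ha0e a00 absz0 exp0n.
have [m [c [a0m sqm m0 c0]]] := sqfree_decomposition a00.
have m1 : m != 1.
  apply/eqP => m1; have := base_not_power a2 he hmax ha0e (r := `|c|%N) (j := 2).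
  by rewrite a0m m1 mul1r abszX => /(_ erefl).
have cK0 : c%:~R != 0 :> K.
  by rewrite (int_alg K) -[_%:A]/(in_alg K _) fmorph_eq0 intr_eq0.
pose s : K := r / c%:~R.
have sm : s ^+ 2 = m%:~R.
  by rewrite expr_div_n hr a0m rmorphM rmorphXn mulfK// expf_neq0.
have Ks : <<1; s>>%VS = {:K}%VS.
  apply/eqP; rewrite eqEsubv subvf -hK; apply/FadjoinP; split; first exact: sub1v.
  have -> : r = c%:~R * s by rewrite mulrC divfK.
  by rewrite rpredM ?memv_adjoin// rpred_int.
have DE := is_discriminant_quadratic sqm m1 m0 sm Ks hD.
have [g1 gM] := hg.
have GE := cardGE a2 he hmax ha0e hsgn a0m sqm m0 c0.
pose f := termA a g.
pose E := ramification_bound a e m.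
have f1 : f 1%N = 1 by rewrite /f /termA (cardA1 a2 he hmax ha0e) g1 divr1.
have fM k l : (0 < k)%N -> (0 < l)%N -> coprime k l -> f (k * l)%N = f k * f l.
  move=> k0 l0 ckl; rewrite /f /termA (cardAM a2 he hmax ha0e)// gM// natrM.
  by rewrite invfM mulrACA.
have sf : small_tails f.
  apply: small_tailsP habs => n n0; rewrite normrM normfV normr_nat.
  have [G0 ->] := GE n n0.
  apply: ler_wpM2l; first exact: normr_ge0.
  rewrite lef_pV2 ?posrE ?ltr0n ?muln_gt0 ?G0; last 2 first.
  - by case: ifP.
  - by [].
  by rewrite ler_nat leq_pmulr//; case: ifP.
have B0 p : prime p -> (0 <= p)%N -> (fun=> 0%N) p = 0%N by [].
have EP0 n : (0 < n)%N ->
    reflect (forall p, prime p -> ((fun=> 0%N) p <= logn p n)%N) (predT n).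
  by move=> n0; apply: ReflectT.
have BD p : prime p -> (`|D| + 3 <= p)%N -> ell a e D p = 0%N.
  move=> pp Dp; rewrite DE ell_odd//.
    have D0 : (0 < `|D|)%N.
      by rewrite DE /quadratic_disc; case: ifP => _; rewrite absz_gt0 ?mulf_neq0.
    case: (boolP (p %| `|m|)%N) => // /dvdn_leq; rewrite absz_gt0 m0 => /(_ isT) pm.
    have : (`|m| <= `|D|)%N.
      by rewrite DE /quadratic_disc; case: ifP => _ //; rewrite abszM leq_pmull.
    by lia.
  by have [p2|//] := even_prime pp; lia.
have EPD n : (0 < n)%N ->
    reflect (forall p, prime p -> (ell a e D p <= logn p n)%N) (E n).
  by move=> n0; rewrite DE; exact: asboolP.
have euler0 := euler_product sf f1 fM B0 EP0.
have eulerE := euler_product sf f1 fM BD EPD.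
have cA0 : cvgn (fun N => \sum_(1 <= n < N | predT n) f n).
  exact: (small_tails_cvgn sf (F := id)).
have cAE : cvgn (fun N => \sum_(1 <= n < N | E n) f n).
  exact: (small_tails_cvgn sf (F := id)).
have sumE : (fun N : nat => \sum_(1 <= n < N) termG a g n) =
    (fun N => \sum_(1 <= n < N | predT n) f n + \sum_(1 <= n < N | E n) f n).
  apply/funext => N; rewrite [X in _ = _ + X]big_mkcond -big_split.
  apply: eq_big_nat => n /andP[n0 _] /=; have [G0 AE] := GE n n0.
  rewrite /termG /f /termA AE -/E natrM; case: ifP => _; last by rewrite mulr1 addr0.
  by rewrite invfM mulrA -splitr.
split.
- by move=> p pp; rewrite /local_partial; exact: (local_series_cvgn sf (l := 0) pp).
- exact: (cvgP _ euler0).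
- exact: (cvgP _ eulerE).
rewrite sumE; exact: (cvgn_lim_add euler0 eulerE cA0 cAE).
Qed.
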